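(* Let $\mathcal S$ be a regular 2-spread of $\mathrm{PG}(5,q)$, and let $\mathbb S\subset\mathcal S$ be an exterior splash with covers $\mathbb C$, $\mathbb T$, whose corresponding triples of transversal lines are $g_{\mathbb S},g_{\mathbb S}^q,g_{\mathbb S}^{q^2}$; $g_{\mathbb C},g_{\mathbb C}^q,g_{\mathbb C}^{q^2}$; and $g_{\mathbb T},g_{\mathbb T}^q,g_{\mathbb T}^{q^2}$, respectively (triples for $\mathbb S$, $\mathbb C$, $\mathbb T$). Then the carriers of $\mathbb S$ are the only two planes of $\mathcal S$ whose extension to $\mathrm{PG}(5,q^3)$ meets all nine transversal lines.
   Context: Let $q$ be a prime power, $\tau$ a primitive element of $\mathbb F_{q^3}$, and for $\alpha=a_0+a_1\tau+a_2\tau^2$ ($a_i\in\mathbb F_q$) write $[\alpha]=(a_0,a_1,a_2)$. Bruck-Bose correspondence at infinity: let $\ell_\infty$ be the line $z=0$ of $\mathrm{PG}(2,q^3)$. A point $L=(\alpha,\beta,0)$ of $\ell_\infty$ corresponds to the plane $[L]=\{([\alpha x],[\beta x]): x\in\mathbb F_{q^3}\setminus\{0\}\}$ of $\mathrm{PG}(5,q)$. The planes $[L]$ form a regular 2-spread $\mathcal S$ (a partition of $\mathrm{PG}(5,q)$ into $q^3+1$ planes containing the 2-regulus determined by any three of its planes), and every regular 2-spread of $\mathrm{PG}(5,q)$ is projectively equivalent to it. An order-$q$-subplane $\pi$ of $\mathrm{PG}(2,q^3)$ is an image of $\mathrm{PG}(2,q)$ under $\mathrm{PGL}(3,q^3)$.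 If $\pi$ is exterior to $\ell_\infty$ (no point of $\pi$ on $\ell_\infty$), its exterior splash is the set of $q^2+q+1$ points of $\ell_\infty$ lying on extended lines of $\pi$; the same term and symbol $\mathbb S$ are used for the corresponding set of planes of $\mathcal S$. Carriers: let $I$ be the subgroup of $\mathrm{PGL}(3,q^3)$ fixing $\pi$ and $\ell_\infty$. It fixes exactly three lines $\ell_\infty,m,n$, which are conjugate with respect to $\pi$ (i.e. images of each other under the order-3 collineation group of $\mathrm{PG}(2,q^3)$ fixing $\pi$ pointwise), and exactly three points $\ell_\infty\cap m$, $\ell_\infty\cap n$, $m\cap n$. The carriers of the exterior splash $\mathbb S$ of $\pi$ are the two points $E_1=\ell_\infty\cap m$ and $E_2=\ell_\infty\cap n$ of $\ell_\infty$. In $\mathrm{PG}(5,q)$ the carriers are the corresponding two planes $[E_1],[E_2]$ of $\mathcal S$. Covers: by a result of Bruck there are two further sets (switching sets) of $q^2+q+1$ planes of $\mathrm{PG}(5,q)$, called the covers of $\mathbb S$ and denoted $\mathbb C$ and $\mathbb T$. Planes in the same set are disjoint, the planes of each of $\mathbb S,\mathbb T,\mathbb C$ cover the same set of points, and planes from different sets meet in exactly one point. Transversals: a transversal line of a set of planes of $\mathrm{PG}(5,q)$ is a line of $\mathrm{PG}(5,q^3)$ meeting the extension of every plane of the set. Each of $\mathbb S,\mathbb C,\mathbb T$ has exactly three transversal lines, forming a conjugate triple $g,g^q,g^{q^2}$ under the Frobenius map $X\mapsto X^q$ on coordinates, disjoint from $\mathrm{PG}(5,q)$. *)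

(* Defs.v *)
From HB Require Import structures.
From mathcomp Require Import all_boot all_order all_algebra fieldext.
From mathcomp Require Import boolp classical_sets functions cardinality.

Set Implicit Arguments.
Unset Strict Implicit.
Unset Printing Implicit Defensive.

Import GRing.Theory.
Local Open Scope ring_scope.
Local Open Scope classical_set_scope.
Local Open Scope card_scope.

(* An s-dimensional subspace of PG(n, K) is a subspace of 'rV[K]_n.+1 of vector
   dimension s + 1: points, lines and planes have \dim equal to 1, 2 and 3. *)

Definition intersects (K : fieldType) (V : vectType K) (U W : {vspace V}) : Prop :=
  (U :&: W)%VS <> 0%VS.

Definition meets_in_point (K : fieldType) (V : vectType K)
    (U W : {vspace V}) : Prop :=
  \dim (U :&: W)%VS = 1%N.

Definition pairwise_disjoint (K : fieldType) (V : vectType K)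
    (X : set {vspace V}) : Prop :=
  forall U W, X U -> X W -> U <> W -> ~ intersects U W.

Definition points_of (K : fieldType) (V : vectType K)
    (X : set {vspace V}) : set {vspace V} :=
  [set P | \dim P = 1%N /\ exists2 U, X U & (P <= U)%VS].

Definition mximg (K : fieldType) (n : nat) (M : 'M[K]_n)
    (U : {vspace 'rV[K]_n}) : {vspace 'rV[K]_n} :=
  (linfun (mulmxr M) @: U)%VS.

Definition two_regulus (F : finFieldType) (R : set {vspace 'rV[F]_6}) : Prop :=
  [/\ R #= `I_(#|F|.+1),
      forall U, R U -> \dim U = 3%N,
      pairwise_disjoint R
    & forall (g U1 U2 U3 : {vspace 'rV[F]_6}), \dim g = 2%N ->
        R U1 -> R U2 -> R U3 -> uniq [:: U1; U2; U3] ->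
        intersects g U1 -> intersects g U2 -> intersects g U3 ->
        forall U, R U -> intersects g U].

Definition two_spread (F : finFieldType) (S : set {vspace 'rV[F]_6}) : Prop :=
  (forall U, S U -> \dim U = 3%N) /\
  (forall P : {vspace 'rV[F]_6}, \dim P = 1%N ->
     exists! U, S U /\ (P <= U)%VS).

(* Three pairwise disjoint planes lie in exactly one 2-regulus. *)
Definition regular_two_spread (F : finFieldType)
    (S : set {vspace 'rV[F]_6}) : Prop :=
  two_spread S /\
  forall U1 U2 U3, S U1 -> S U2 -> S U3 -> uniq [:: U1; U2; U3] ->
    forall R, two_regulus R -> R U1 -> R U2 -> R U3 -> R `<=` S.

Definition primitive_element (F : finFieldType) (L : fieldExtType F)
    (tau : L) : Prop :=
  ((#|F| ^ \dim {:L}).-1).-primitive_root tau.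

Definition coords (F : finFieldType) (L : fieldExtType F) (tau a : L) :
    'rV[F]_3 :=
  \row_i coord [tuple 1; tau; tau ^+ 2] i a.

Definition line_infty (K : fieldType) : {vspace 'rV[K]_3} :=
  <<[:: (delta_mx 0 0)%R; (delta_mx 0 1)%R]>>%VS.

(* The plane [P] for a point P = (a, b, 0) of the line at infinity; it does not
   depend on the homogeneous coordinates chosen by vpick. *)
Definition bb_plane (F : finFieldType) (L : fieldExtType F) (tau : L)
    (P : {vspace 'rV[L]_3}) : {vspace 'rV[F]_6} :=
  let a := vpick P 0 0 in
  let b := vpick P 0 1 in
  limg (linfun (fun x : L =>
    row_mx (coords tau (a * x)) (coords tau (b * x)) : 'rV[F]_6)).

Definition bb_spread (F : finFieldType) (L : fieldExtType F) (tau : L) :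
    set {vspace 'rV[F]_6} :=
  bb_plane tau @` [set P | \dim P = 1%N /\ (P <= line_infty L)%VS].

(* Subspaces are F-rational when spanned by the image of a subspace over F. *)
Definition extension (F : finFieldType) (L : fieldExtType F) (n : nat)
    (U : {vspace 'rV[F]_n}) : {vspace 'rV[L]_n} :=
  <<[seq map_mx (in_alg L) u | u <- vbasis U]>>%VS.

(* X |-> X^q maps a subspace onto the span of the images of any of its bases. *)
Definition conjugate (F : finFieldType) (L : fieldExtType F) (n : nat)
    (U : {vspace 'rV[L]_n}) : {vspace 'rV[L]_n} :=
  <<[seq map_mx (fun x : L => x ^+ #|F|) u | u <- vbasis U]>>%VS.

(* An order-q-subplane is given by its set of points. *)
Definition order_q_subplane (F : finFieldType) (L : fieldExtType F)
    (pi : set {vspace 'rV[L]_3}) : Prop :=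
  exists2 M : 'M[L]_3, M \in unitmx &
    pi = (fun P : {vspace 'rV[F]_3} => mximg M (extension L P)) @`
           [set P | \dim P = 1%N].

Definition exterior (K : fieldType) (pi : set {vspace 'rV[K]_3}) : Prop :=
  forall P, pi P -> ~ (P <= line_infty K)%VS.

Definition extended_line (K : fieldType) (pi : set {vspace 'rV[K]_3})
    (l : {vspace 'rV[K]_3}) : Prop :=
  \dim l = 2%N /\
  exists P Q, [/\ pi P, pi Q, P <> Q, (P <= l)%VS & (Q <= l)%VS].

Definition splash (K : fieldType) (pi : set {vspace 'rV[K]_3}) :
    set {vspace 'rV[K]_3} :=
  [set P | [/\ \dim P = 1%N, (P <= line_infty K)%VS
             & exists2 l, extended_line pi l & (P <= l)%VS]].

(* Representatives of the elements of the subgroup I of PGL(3, q^3) that fixes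
   pi and the line at infinity. *)
Definition stab_subplane (K : fieldType) (pi : set {vspace 'rV[K]_3}) :
    set 'M[K]_3 :=
  [set M | [/\ M \in unitmx, mximg M @` pi = pi
             & mximg M (line_infty K) = line_infty K]].

Definition fixed_lines (K : fieldType) (pi : set {vspace 'rV[K]_3}) :
    set {vspace 'rV[K]_3} :=
  [set l | \dim l = 2%N /\ forall M, stab_subplane pi M -> mximg M l = l].

Definition carrier_points (K : fieldType) (pi : set {vspace 'rV[K]_3})
    (E1 E2 : {vspace 'rV[K]_3}) : Prop :=
  exists m n : {vspace 'rV[K]_3},
    [/\ uniq [:: line_infty K; m; n],
        fixed_lines pi = [set line_infty K; m; n],
        E1 = (line_infty K :&: m)%VS
      & E2 = (line_infty K :&: n)%VS].

(* SS is an exterior splash of the regular 2-spread S, with carriers E1 and E2.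
   The Bruck-Bose correspondence is transported to S by a projectivity N taking
   the spread of the planes [P] to S. *)
Definition exterior_splash (F : finFieldType) (L : fieldExtType F) (tau : L)
    (S SS : set {vspace 'rV[F]_6}) (E1 E2 : {vspace 'rV[F]_6}) : Prop :=
  exists (N : 'M[F]_6) (pi : set {vspace 'rV[L]_3})
         (P1 P2 : {vspace 'rV[L]_3}),
    [/\ N \in unitmx /\ S = mximg N @` bb_spread tau,
        order_q_subplane pi /\ exterior pi,
        SS = (fun P => mximg N (bb_plane tau P)) @` splash pi,
        carrier_points pi P1 P2
      & E1 = mximg N (bb_plane tau P1) /\ E2 = mximg N (bb_plane tau P2)].

(* A set of q^2 + q + 1 mutually disjoint planes. *)
Definition cover_size_set (F : finFieldType)
    (X : set {vspace 'rV[F]_6}) : Prop :=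
  [/\ X #= `I_(#|F| ^ 2 + #|F| + 1)%N,
      forall U, X U -> \dim U = 3%N
    & pairwise_disjoint X].

Definition switching (F : finFieldType) (X Y : set {vspace 'rV[F]_6}) : Prop :=
  points_of X = points_of Y /\
  forall U W, X U -> Y W -> meets_in_point U W.

(* These properties determine the unordered pair {C, T}. *)
Definition covers (F : finFieldType) (SS C T : set {vspace 'rV[F]_6}) : Prop :=
  [/\ cover_size_set C, cover_size_set T,
      switching SS C, switching SS T & switching C T].

Definition transversal_line (F : finFieldType) (L : fieldExtType F)
    (X : set {vspace 'rV[F]_6}) (g : {vspace 'rV[L]_6}) : Prop :=
  \dim g = 2%N /\ forall U, X U -> intersects g (extension L U).

Definition conjugate_triple (F : finFieldType) (L : fieldExtType F)
    (g : {vspace 'rV[L]_6}) : set {vspace 'rV[L]_6} :=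
  [set g; conjugate g; conjugate (conjugate g)].

Definition transversal_triple (F : finFieldType) (L : fieldExtType F)
    (X : set {vspace 'rV[F]_6}) (g : {vspace 'rV[L]_6}) : Prop :=
  [set h | transversal_line X h] = conjugate_triple g.

(* Main.v *)
Require Import Defs.
From HB Require Import structures.
From mathcomp Require Import all_boot all_order all_algebra.
From mathcomp Require Import falgebra fieldext finfield.
From mathcomp Require Import boolp classical_sets functions cardinality.
From mathcomp Require Import ring zify.

Set Implicit Arguments.
Unset Strict Implicit.
Unset Printing Implicit Defensive.

Import GRing.Theory.
Local Open Scope ring_scope.
Local Open Scope classical_set_scope.

(** Write s for the Frobenius map [frob] of the cubic extension L of F and
    N x = x (s x) (s (s x)) for its norm [norm3].  The idea is to choose
    coordinates in which the splash, its carriers and its covers become graphs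
    of monomial maps, and then to diagonalise by extending scalars to L.

    The plane.  Since pi misses the line at infinity, the last coordinate
    identifies the rational vectors of pi with L, and the F-linear
    parametrisation of pi reads x w0 + (s x) w1 + (s (s x)) w2 for a basis
    w0, w1, w2 of L^3 in which the line at infinity is <w1, w2>
    ([exterior_frame]).  A collineation fixing both pi and that line is diagonal
    in this basis ([stab_frame]), so the two other fixed lines are <w0, w1> and
    <w0, w2>, and the carriers are <w1> and <w2> ([carriers_frame]).  The lines
    of pi meet the line at infinity exactly in the points <w1 - b w2> with
    N b = 1 ([splash_frame]).

    PG(5,q).  Bruck-Bose turns this into F^6 = L + L: the spread consists of the
    planes {(a x, b x)}, the splash of the planes {(x, b x)} with N b = 1, and
    the carriers are {(x, 0)} and {(0, x)}.  A plane of a cover avoids the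
    second carrier, so it is the graph of an F-linear map
    f x = a x + b (s x) + c (s (s x)); it meets every plane of the splash, so
    f - d is singular for each d with N d = 1.  The determinant of f - d, with
    N d replaced by 1, is a polynomial in d of degree at most q^2 + q with
    q^2 + q + 1 roots, hence zero, and its coefficients give a = 0 and b c = 0
    ([singular_all_norm1]).  By Hilbert 90 the graphs of b (s x) and
    c (s (s x)) always meet, so a cover contains graphs of one kind only
    ([cover_homogeneous]).

    PG(5,q^3).  Over L the space splits as <e0, e1, e2> + <f0, f1, f2>, the
    element (x, y) having coordinates
    (x, s x, s (s x); y, s y, s (s y)).  The transversals of the splash are the
    lines <ei, fi>, and those of each cover are the lines <ei, fj> for one of
    the two cyclic shifts i |-> j without fixed index.  The extended carriers
    are <e0, e1, e2> and <f0, f1, f2>, which meet all nine lines; any other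
    spread plane extends to <a e0 + b f0, (s a) e1 + (s b) f1, ...> with a and b
    nonzero, which meets no <ei, fj> with i <> j ([spread_plane_skew]). *)

(** * The Frobenius map of a cubic extension of a finite field *)

Section Frobenius.
Context (F : finFieldType) (L : fieldExtType F).
Implicit Types (x y z : L) (a : F).

Definition frob x : L := x ^+ #|F|.

Fact frob_is_zmod_morphism : zmod_morphism frob.
Proof.
move=> x y; rewrite /frob.
have [p _ pcharFp] := finPcharP F; rewrite (card_pprimeChar pcharFp).
elim: (logn _ _) => // n IHn; rewrite expnSr !exprM {}IHn.
by rewrite -(pchar_lalg L) in pcharFp; rewrite -pFrobenius_autE rmorphB.
Qed.

Fact frob_is_monoid_morphism : monoid_morphism frob.
Proof. by rewrite /frob; split=> [|x y]; rewrite ?exprMn ?expr1n. Qed.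

HB.instance Definition _ :=
  GRing.isZmodMorphism.Build L L frob frob_is_zmod_morphism.
HB.instance Definition _ :=
  GRing.isMonoidMorphism.Build L L frob frob_is_monoid_morphism.

Lemma frob_alg a : frob a%:A = a%:A.
Proof. by rewrite /frob -in_algE -rmorphXn expf_card. Qed.

Lemma frob_fixed x : frob x = x -> exists a : F, x = a%:A.
Proof.
move=> sx; suff /vlineP[a ->]: x \in (1%VS : {vspace L}) by exists a.
by rewrite (Fermat's_little_theorem (aspace1 L)) dimv1 expn1; apply/eqP.
Qed.

Definition norm3 x := x * frob x * frob (frob x).

Lemma norm3M x y : norm3 (x * y) = norm3 x * norm3 y.
Proof. by rewrite /norm3 !rmorphM; ring. Qed.

Lemma norm3V x : norm3 x^-1 = (norm3 x)^-1.
Proof. by rewrite /norm3 !fmorphV !invfM. Qed.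

Lemma norm3_neq0 x : norm3 x = 1 -> x != 0.
Proof.
by move=> Nx; apply/eqP => x0; have /eqP := oner_neq0 L;
  rewrite -Nx x0 /norm3 !mul0r.
Qed.

(** The normal form of F-linear maps from L to an L-space: over L, the three
    conjugates of the argument are independent coordinates on L, and every
    F-linear map is a [twist] by [linear_twist]. *)
Definition twist n (e0 e1 e2 : 'rV[L]_n) x : 'rV[L]_n :=
  x *: e0 + frob x *: e1 + frob (frob x) *: e2.

Lemma twist_linear n (e0 e1 e2 : 'rV[L]_n) a x y :
  twist e0 e1 e2 (a *: x + y) = a%:A *: twist e0 e1 e2 x + twist e0 e1 e2 y.
Proof.
apply/rowP => j; rewrite !mxE -(mulr_algl a x).
by rewrite !(rmorphD, rmorphM) /= !frob_alg; ring.
Qed.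

Section Cubic.
Hypothesis dimL : \dim {:L} = 3%N.

Lemma frob3 x : frob (frob (frob x)) = x.
Proof.
rewrite /frob -!exprM; apply/eqP.
have := Fermat's_little_theorem (aspacef L) x.
by rewrite dimL memvf !expnS expn0 muln1 mulnA => /esym.
Qed.

Lemma norm3_frob x : norm3 (frob x) = norm3 x.
Proof. by rewrite /norm3 frob3; ring. Qed.

Section Primitive.
Variable tau : L.
Hypothesis prim_tau : primitive_element tau.

Let q_gt1 : (1 < #|F|)%N. Proof. exact: finNzRing_gt1. Qed.

Lemma primitive_neq_frob : frob tau != tau.
Proof.
rewrite /frob -{2}[tau]expr1 (eq_prim_root_expr prim_tau) dimL.
by rewrite !modn_small -?subn1; nia.
Qed.

Lemma frob_tau01 : tau - frob tau != 0.
Proof. by rewrite subr_eq0 eq_sym primitive_neq_frob. Qed.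

Lemma frob_tau12 : frob tau - frob (frob tau) != 0.
Proof. by rewrite -rmorphB fmorph_eq0 frob_tau01. Qed.

Lemma frob_tau20 : frob (frob tau) - tau != 0.
Proof. by rewrite -{2}(frob3 tau) -!rmorphB /= !fmorph_eq0 frob_tau01. Qed.

(** The [n]-th roots of unity are all in L as soon as [n] divides its number of
    nonzero elements, so they are too many for a polynomial of degree below
    [n]. *)
Lemma poly_roots_unity0 n k (p : {poly L}) :
  (n * k)%N = (#|F| ^ 3).-1 -> (size p <= n)%N ->
  (forall x, x ^+ n = 1 -> p.[x] = 0) -> p = 0.
Proof.
move=> nk szp p0; apply/eqP; apply: contraTT (szp) => pn0; rewrite -ltnNge.
have n0 : (0 < n)%N.
  case: n nk {szp p0} => //; have : (1 < #|F| ^ 3)%N by nia.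
  by rewrite mul0n -subn1; lia.
have prim : n.-primitive_root (tau ^+ k).
  have := dvdn_prim_root prim_tau; rewrite dimL -nk; move/(_ n).
  rewrite dvdn_mulr // mulKn //; exact.
have := max_poly_roots pn0 (rs := [seq (tau ^+ k) ^+ i | i <- iota 0 n]).
rewrite size_map size_iota; apply.
  apply/allP => _ /mapP[i _ ->].
  by rewrite rootE p0 // exprAC (prim_expr_order prim) expr1n.
rewrite map_inj_in_uniq ?iota_uniq // => i j.
rewrite !mem_iota => /andP[_ hi] /andP[_ hj] /eqP.
by rewrite (eq_prim_root_expr prim) !modn_small // => /eqP.
Qed.

(** Lagrange interpolation: the values at [1], [tau] and [tau ^+ 2] already
    determine the three coefficients, because the conjugates of [tau] are
    distinct. *)
Lemma twist_span n (e0 e1 e2 : 'rV[L]_n) (U : {vspace 'rV[L]_n}) :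
  (forall x, twist e0 e1 e2 x \in U) -> [/\ e0 \in U, e1 \in U & e2 \in U].
Proof.
move=> tU.
have lagrange (f0 f1 f2 : 'rV[L]_n) (r s t : L) :
    (forall k, r ^+ k *: f0 + s ^+ k *: f1 + t ^+ k *: f2 \in U) ->
    r - s != 0 -> t - r != 0 -> f0 \in U.
  move=> hU rs tr.
  pose v k := r ^+ k *: f0 + s ^+ k *: f1 + t ^+ k *: f2.
  have -> : f0 = ((r - s) * (r - t))^-1 *:
      (v 2 - (s + t) *: v 1 + (s * t) *: v 0).
    apply/rowP => j; rewrite !mxE; field.
    by rewrite rs -opprB oppr_eq0 tr.
  by rewrite memvZ // memvD ?memvB ?memvZ ?hU.
have tU' k :
    tau ^+ k *: e0 + frob tau ^+ k *: e1 + frob (frob tau) ^+ k *: e2 \in U.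
  by have := tU (tau ^+ k); rewrite /twist !rmorphXn.
split.
- exact: lagrange tU' frob_tau01 frob_tau20.
- apply: (lagrange e1 e2 e0 (frob tau) (frob (frob tau)) tau) => [k||].
  + by rewrite addrC addrA; apply: tU'.
  + exact: frob_tau12.
  + exact: frob_tau01.
- apply: (lagrange e2 e0 e1 (frob (frob tau)) tau (frob tau)) => [k||].
  + by rewrite -addrA addrC; apply: tU'.
  + exact: frob_tau20.
  + exact: frob_tau12.
Qed.

Lemma twist_eq0 n (e0 e1 e2 : 'rV[L]_n) :
  (forall x, twist e0 e1 e2 x = 0) -> [/\ e0 = 0, e1 = 0 & e2 = 0].
Proof.
move=> t0; have [|h0 h1 h2] := @twist_span n e0 e1 e2 0%VS.
  by move=> x; rewrite t0 mem0v.
by split; apply/eqP; rewrite -memv0.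
Qed.

Lemma lin_comb_frob_eq0 (c0 c1 c2 : L) :
  (forall x, c0 * x + c1 * frob x + c2 * frob (frob x) = 0) ->
  [/\ c0 = 0, c1 = 0 & c2 = 0].
Proof.
move=> h.
have [x|] := @twist_eq0 1 (const_mx c0) (const_mx c1) (const_mx c2).
  by apply/rowP => j; rewrite !mxE -[RHS](h x); ring.
by move=> /rowP/(_ 0) + /rowP/(_ 0) + /rowP/(_ 0); rewrite !mxE.
Qed.

(** The usual witness: for any [u], the sum
    [u + b * frob u + b * frob b * frob (frob u)] is a solution, and it is not
    zero for every [u]. *)
Lemma hilbert90 (b : L) : norm3 b = 1 -> exists2 t, t != 0 & b * frob t = t.
Proof.
move=> Nb.
have [t tn0] : exists t, t + b * frob t + b * frob b * frob (frob t) != 0.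
  apply: contrapT => /forallNP h.
  have [|c0 _ _] := @lin_comb_frob_eq0 1 b (b * frob b).
    by move=> x; rewrite mul1r; apply/eqP/negP => hx; apply: (h x); apply/negP.
  by move/eqP: c0; rewrite oner_eq0.
exists (t + b * frob t + b * frob b * frob (frob t)) => //.
rewrite !rmorphD !rmorphM /= frob3.
have /esym e := congr1 (fun z => z * t) Nb; rewrite mul1r in e.
by rewrite [X in _ = X + _ + _]e /norm3; ring.
Qed.

(** The exponents 0, 1, q, q^2, q+1, q^2+q, q^2+1 are distinct and smaller than
    q^2+q+1, the number of elements of norm one, so the hypothesis says that a
    polynomial has more roots than its degree. *)
Lemma norm1_poly_eq0 (k u0 u1 u2 v0 v1 v2 : L) :
  (forall b, norm3 b = 1 ->
     k + u0 * b + u1 * frob b + u2 * frob (frob b)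
     + v0 * (b * frob b) + v1 * (frob b * frob (frob b))
     + v2 * (frob (frob b) * b) = 0) ->
  [/\ k = 0, u0 = 0 & v0 = 0].
Proof.
move=> h; set q := #|F|.
pose p : {poly L} := k%:P + u0 *: 'X + u1 *: 'X^q + u2 *: 'X^(q * q)
  + v0 *: 'X^(q.+1) + v1 *: 'X^(q + q * q) + v2 *: 'X^((q * q).+1).
have p0 : p = 0.
  apply: (@poly_roots_unity0 (q ^ 2 + q + 1) (q.-1)).
  - rewrite -/q -!subn1; have : (1 < q)%N by []. nia.
  - have q1 : (1 < q)%N by [].
    rewrite /p; do ![apply: (leq_trans (size_polyD _ _));
      rewrite geq_max; apply/andP; split];
      rewrite ?(leq_trans (size_scale_leq _ _)) ?size_polyXn ?size_polyX;
      rewrite ?(leq_trans (size_polyC_leq1 _)) //; nia.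
  - move=> b; rewrite !exprD !expr1 => hb.
    rewrite /p !hornerE -[RHS](h b); last first.
      by rewrite /norm3 /frob -/q -[RHS]hb -exprM expnS expn1; ring.
    by rewrite /frob -/q -!exprM ?exprS ?exprD; ring.
have q1 : (1 < q)%N by [].
have qq : (q * 2 <= q * q)%N by nia.
have c j : k *+ (j == 0)%N + u0 *+ (j == 1)%N + u1 *+ (j == q) +
    u2 *+ (j == q * q)%N + v0 *+ (j == q.+1) + v1 *+ (j == q + q * q)%N +
    v2 *+ (j == (q * q).+1) = 0.
  by rewrite -[RHS](coef0 L j) -p0 /p !coefE !mulr_natr; case: (j == 0)%N.
have neq (m n : nat) : m <> n -> (m == n) = false by move=> ?; apply/eqP.
split.
- by have := c 0%N; rewrite eqxx; rewrite !(neq 0%N) ?mulr0n ?addr0 //; lia.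
- have := c 1%N; rewrite eqxx.
  by rewrite !(neq 1%N) ?mulr0n ?addr0 ?add0r //; lia.
- have := c q.+1; rewrite eqxx.
  by rewrite !(neq q.+1) ?mulr0n ?addr0 ?add0r //; lia.
Qed.

Lemma tau_free (a b c : F) :
  a%:A + b%:A * tau + c%:A * tau ^+ 2 = 0 -> [/\ a = 0, b = 0 & c = 0].
Proof.
move=> e0.
have alg0 (d : F) : d%:A = 0 :> L -> d = 0.
  by move/eqP; rewrite scaler_eq0 oner_eq0 orbF => /eqP.
set t := tau in e0; pose t1 := frob t; pose t2 := frob t1.
have frob_quad (y : L) : a%:A + b%:A * y + c%:A * y ^+ 2 = 0 ->
    a%:A + b%:A * frob y + c%:A * frob y ^+ 2 = 0.
  move=> y0; rewrite -[RHS](rmorph0 (frob)) -y0.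
  by rewrite !(rmorphD, rmorphM, rmorphXn) /= !frob_alg.
have e1 := frob_quad _ e0; have e2 := frob_quad _ e1.
rewrite -/t1 -/t2 in e1 e2.
pose p (y : L) := a%:A + b%:A * y + c%:A * y ^+ 2.
(* A quadratic polynomial with the three distinct roots t, t1, t2 is zero. *)
have c0 : c%:A = 0 :> L.
  apply: (mulfI frob_tau01); apply: (mulfI frob_tau12).
  apply: (mulfI frob_tau20); rewrite !mulr0 -/t -/t1 -/t2.
  transitivity ((t2 - t1) * p t + (t - t2) * p t1 + (t1 - t) * p t2).
    by rewrite /p; ring.
  by rewrite /p e0 e1 e2; ring.
have b0 : b%:A = 0 :> L.
  apply: (mulfI frob_tau01); rewrite mulr0 -/t -/t1.
  transitivity (p t - p t1 - c%:A * (t ^+ 2 - t1 ^+ 2)).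
    by rewrite /p; ring.
  by rewrite /p e0 e1 c0; ring.
by move: e0; rewrite b0 c0 !mul0r !addr0; split; apply: alg0.
Qed.

Lemma tau_basis : basis_of {:L} [tuple 1; tau; tau ^+ 2].
Proof.
rewrite basisEfree subvf dimL !andbT /=.
apply/freeP => k; rewrite !big_ord_recl big_ord0 /= addr0 addrA => e.
have [|k0 k1 k2] := @tau_free (k ord0) (k (lift ord0 ord0))
    (k (lift ord0 (lift ord0 ord0))).
  by rewrite !mulr_algl.
move=> j; case: (unliftP ord0 j) => [i ->|->] //.
case: (unliftP ord0 i) => [h ->|->] //.
by rewrite ord1.
Qed.

Lemma tau_decomp x : exists a b c : F, x = a%:A + b%:A * tau + c%:A * tau ^+ 2.
Proof.
have := coord_basis tau_basis (memvf x).
rewrite !big_ord_recl big_ord0 addr0 addrA /= => ->.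
by do 3![eexists]; rewrite !mulr_algl.
Qed.

(** The coefficients are those of the Lagrange interpolation through the
    conjugates of [tau]; both sides are F-linear and agree on the basis
    [1], [tau], [tau ^+ 2]. *)
Lemma linear_twist n (f : L -> 'rV[L]_n) :
  (forall (a : F) x y, f (a *: x + y) = a%:A *: f x + f y) ->
  exists e0 e1 e2, f =1 twist e0 e1 e2.
Proof.
move=> flin.
pose e r s t := ((r - s) * (r - t))^-1 *:
  (f (tau ^+ 2) - (s + t) *: f tau + (s * t) *: f 1).
pose t1 := frob tau; pose t2 := frob t1.
exists (e tau t1 t2), (e t1 t2 tau), (e t2 tau t1) => x.
have f0 : f 0 = 0.
  have := flin 1 0 0; rewrite !scale1r addr0.
  by move/eqP; rewrite -subr_eq subrr eq_sym => /eqP.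
have h01 : tau - t1 != 0 := frob_tau01.
have h12 : t1 - t2 != 0 := frob_tau12.
have h20 : t2 - tau != 0 := frob_tau20.
have [a [b [c ->]]] := tau_decomp x.
have -> : f (a%:A + b%:A * tau + c%:A * tau ^+ 2) =
    a%:A *: f 1 + (b%:A *: f tau + c%:A *: f (tau ^+ 2)).
  rewrite !mulr_algl -addrA flin flin; congr (_ + (_ + _)).
  by rewrite -[X in f X]addr0 flin f0 addr0.
apply/rowP => j; rewrite !mxE expr2 !(rmorphD, rmorphM) /= !frob_alg -/t1 -/t2.
field.
rewrite -[t1 - tau]opprB -[t2 - t1]opprB -[tau - t2]opprB !oppr_eq0.
by rewrite h01 h12 h20.
Qed.

End Primitive.

End Cubic.

End Frobenius.

(** * Points, lines and planes as subspaces *)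

Section Subspaces.
Context (K : fieldType) (V : vectType K).
Implicit Types (U W P : {vspace V}) (u v w : V).

Lemma intersectsP U W :
  intersects U W <-> exists v, [/\ v != 0, v \in U & v \in W].
Proof.
split=> [/eqP|[v [vn0 vU vW] UW0]].
  rewrite -subv0 => /subvPn[v]; rewrite memv_cap memv0 => /andP[vU vW] vn0.
  by exists v.
have : v \in (U :&: W)%VS by rewrite memv_cap vU vW.
by rewrite UW0 memv0 (negPf vn0).
Qed.

Lemma dim1P U : \dim U = 1%N <-> exists2 v, v != 0 & U = <[v]>%VS.
Proof.
split=> [dU|[v vn0 ->]]; last by rewrite dim_vline vn0.
have vn0 : vpick U != 0 by rewrite vpick0 -dimv_eq0 dU.
exists (vpick U) => //; apply/esym/eqP.
by rewrite eqEdim -memvE memv_pick dU dim_vline vn0.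
Qed.

Lemma vline_eqP u v : v != 0 -> <[u]>%VS = <[v]>%VS ->
  exists2 c, c != 0 & u = c *: v.
Proof.
move=> vn0 uv; have /vlineP[c uE] : u \in <[v]>%VS by rewrite -uv memv_line.
exists c => //; apply: contraNneq vn0 => c0.
have := memv_line v; rewrite -uv uE c0 scale0r => /vlineP[d ->].
by rewrite scaler0.
Qed.

Lemma vlineZ c v : c != 0 -> <[c *: v]>%VS = <[v]>%VS.
Proof.
move=> cn0; apply/eqP; rewrite eqEsubv -!memvE memvZ ?memv_line //=.
by rewrite -[X in X \in _](scalerK cn0) memvZ ?memv_line.
Qed.

Lemma span2P u w v :
  reflect (exists a b, v = a *: u + b *: w) (v \in <<[:: u; w]>>%VS).
Proof.
rewrite span_cons span_seq1; apply: (iffP memv_addP).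
  by case=> _ /vlineP[a ->] [_ /vlineP[b ->] ->]; exists a, b.
case=> a [b ->]; exists (a *: u); first by rewrite memvZ ?memv_line.
by exists (b *: w); rewrite ?memvZ ?memv_line.
Qed.

Lemma span3P u v w z :
  reflect (exists a b c, z = a *: u + b *: v + c *: w)
    (z \in <<[:: u; v; w]>>%VS).
Proof.
rewrite span_cons; apply: (iffP memv_addP).
  case=> _ /vlineP[a ->] [_ /span2P[b [c ->]] ->]; exists a, b, c; exact: addrA.
case=> a [b [c ->]]; exists (a *: u); first by rewrite memvZ ?memv_line.
by exists (b *: v + c *: w); [apply/span2P; exists b, c | rewrite addrA].
Qed.

Lemma dim_span2 u v : (forall a b, a *: u + b *: v = 0 -> a = 0 /\ b = 0) ->
  \dim <<[:: u; v]>> = 2%N.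
Proof.
move=> uv; apply/eqP; rewrite -/(size [:: u; v]) -/(free _).
rewrite free_cons seq1_free span_seq1.
apply/andP; split; last first.
  apply/eqP => v0; have [|_ /eqP] := uv 0 1; last by rewrite oner_eq0.
  by rewrite v0 scaler0 scale0r addr0.
apply/negP => /vlineP[c uE].
have [|/eqP] := uv 1 (- c); last by rewrite oner_eq0.
by rewrite scale1r uE scaleNr subrr.
Qed.

Definition indep3 u v w := forall a b c,
  a *: u + b *: v + c *: w = 0 -> [/\ a = 0, b = 0 & c = 0].

End Subspaces.

Section MatrixAction.
Context (K : fieldType) (n : nat).
Implicit Types (M : 'M[K]_n) (U : {vspace 'rV[K]_n}).

Lemma mximgP M U v :
  reflect (exists2 u, u \in U & v = u *m M) (v \in mximg M U).
Proof. by apply: (iffP memv_imgP) => -[u uU ->]; exists u; rewrite ?lfunE. Qed.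

Lemma mximg_line M v : mximg M <[v]> = <[v *m M]>%VS.
Proof. by rewrite /mximg limg_line lfunE. Qed.

Lemma mximg_dim M U : M \in unitmx -> \dim (mximg M U) = \dim U.
Proof.
move=> uM; apply/limg_dim_eq/eqP; rewrite -subv0; apply/subvP => v.
rewrite memv_cap memv_ker lfunE /= memv0 => /andP[_ /eqP v0].
by rewrite -(mulmxK uM v) v0 mul0mx.
Qed.

End MatrixAction.

Section Extension.
Context (F : finFieldType) (L : fieldExtType F) (n : nat).
Implicit Types (U : {vspace 'rV[F]_n}) (W : {vspace 'rV[L]_n}) (u : 'rV[F]_n).

Lemma map_algZD (a : F) u v :
  map_mx (in_alg L) (a *: u + v) =
    a%:A *: map_mx (in_alg L) u + map_mx (in_alg L) v.
Proof. by rewrite map_mxD map_mxZ. Qed.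

Lemma mem_extension U u : u \in U -> map_mx (in_alg L) u \in extension L U.
Proof.
move=> /coord_vbasis ->; rewrite raddf_sum rpred_sum // => i _ /=.
rewrite map_mxZ memvZ // memv_span // map_f //.
by rewrite mem_nth // size_tuple.
Qed.

Lemma extension_sub U W :
  (forall u, u \in U -> map_mx (in_alg L) u \in W) -> (extension L U <= W)%VS.
Proof.
move=> UW; apply/span_subvP => _ /mapP[u uU ->].
by apply: UW; rewrite vbasis_mem.
Qed.

Lemma extension_line u : extension L <[u]> = <[map_mx (in_alg L) u]>%VS.
Proof.
apply/eqP; rewrite eqEsubv -memvE mem_extension ?memv_line // andbT.
apply: extension_sub => _ /vlineP[a ->].
by rewrite map_mxZ memvZ ?memv_line.
Qed.

End Extension.

(** * A frame adapted to an exterior subplane *)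

Lemma line_inftyP (K : fieldType) (v : 'rV[K]_3) :
  (v \in line_infty K) = (v 0 2 == 0).
Proof.
apply/span2P/eqP => [[a [b ->]]|v2].
  by rewrite !mxE /= !mulr0 addr0.
exists (v 0 0), (v 0 1); apply/rowP => j; rewrite !mxE.
case: (unliftP 0 j) => [i ->|->] /=; last by rewrite mulr0 mulr1 addr0.
case: (unliftP 0 i) => [h ->|->] /=.
  by rewrite ord1 !mulr0 addr0 -[RHS]v2; congr (v _ _); apply: val_inj.
by rewrite mulr0 mulr1 add0r; congr (v _ _); apply: val_inj.
Qed.

Section Subplane.
Context (F : finFieldType) (L : fieldExtType F).
Hypothesis dimL : \dim {:L} = 3%N.
Variable tau : L.
Hypothesis prim_tau : primitive_element tau.

(** A basis of L^3 in which the points of [pi] are the vectors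
    [(x, frob x, frob (frob x))].  The three lines spanned by two of the basis
    vectors are the conjugates of the line at infinity with respect to [pi]:
    the semilinear map cycling the coordinates fixes [pi] pointwise. *)
Record subplane_frame (pi : set {vspace 'rV[L]_3}) (w0 w1 w2 : 'rV[L]_3) := {
  frame0 : w0 0 2 = 1;
  frame1 : w1 0 2 = 0;
  frame2 : w2 0 2 = 0;
  frame_span : forall v, exists a b c, v = a *: w0 + b *: w1 + c *: w2;
  frame_indep : indep3 w0 w1 w2;
  frame_points : forall P, pi P <->
    exists2 x, x != 0 & P = <[twist w0 w1 w2 x]>%VS
}.

(** The last coordinate of a rational vector of [pi] is nonzero, so it gives an
    F-linear bijection from F^3 to L.  Read through its inverse [k], the points
    of [pi] are parametrised by L, and [linear_twist] applies. *)
Lemma exterior_frame pi : order_q_subplane pi -> exterior pi ->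
  exists w0 w1 w2, subplane_frame pi w0 w1 w2.
Proof.
case=> M uM piE ext.
have point (u : 'rV[F]_3) : u != 0 -> pi <[map_mx (in_alg L) u *m M]>%VS.
  move=> un0; rewrite piE; exists <[u]>%VS; first by rewrite /= dim_vline un0.
  by rewrite extension_line mximg_line.
pose h (u : 'rV[F]_3) : L := (map_mx (in_alg L) u *m M) 0 2.
have h_lin : linear h.
  move=> a u v; rewrite /h map_algZD mulmxDl -scalemxAl.
  rewrite [LHS]mxE [X in X + _]mxE.
  by rewrite mulr_algl.
pose H : {linear 'rV[F]_3 -> L} :=
  HB.pack h (GRing.isLinear.Build F _ _ _ h h_lin).
have kerH : lker (linfun H) == 0%VS.
  rewrite -subv0; apply/subvP => u; rewrite memv_ker lfunE /= memv0 => hu.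
  apply: contraTT hu => /point/ext/negP; rewrite -memvE line_inftyP; exact.
have imH : limg (linfun H) = fullv.
  apply/eqP; rewrite eqEdim subvf /= limg_dim_eq.
    by rewrite dimL dimvf.
  by rewrite (eqP kerH) capv0.
pose k := (linfun H)^-1%VF.
have hk x : h (k x) = x.
  have := @limg_lfunVK _ _ _ (linfun H) x; rewrite imH memvf lfunE; exact.
have kh u : k (h u) = u by have := lker0_lfunK kerH u; rewrite lfunE.
have [|w0 [w1 [w2 fE]]] :=
    linear_twist dimL prim_tau (f := fun x => map_mx (in_alg L) (k x) *m M).
  by move=> a x y; rewrite linearP map_algZD mulmxDl -scalemxAl.
have span v : v \in <<[:: w0; w1; w2]>>%VS.
  rewrite -(mulmxKV uM v); move: (v *m _) => u.
  have -> : u *m M = \sum_j u 0 j *: (map_mx (in_alg L) (delta_mx 0 j) *m M).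
    rewrite {1}[u]row_sum_delta mulmx_suml; apply: eq_bigr => j _.
    by rewrite map_delta_mx -scalemxAl.
  apply: rpred_sum => j _; rewrite memvZ //.
  rewrite -(kh (delta_mx 0 j)); set x := h _; rewrite (fE x).
  by apply/span3P; exists x, (frob x), (frob (frob x)).
(* By construction the last coordinate of the vector of parameter x is x. *)
have [f0 f1 f2] : [/\ w0 0 2 - 1 = 0, w1 0 2 = 0 & w2 0 2 = 0].
  apply: (lin_comb_frob_eq0 dimL prim_tau) => x.
  have := congr1 (fun v : 'rV_3 => v 0 2) (fE x).
  rewrite -/(h (k x)) hk /twist !mxE.
  by move=> xE; rewrite mulrBl mul1r [X in _ - X + _ + _]xE; ring.
exists w0, w1, w2; split => //.
- by apply/eqP; rewrite -subr_eq0 f0.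
- by move=> v; have /span3P := span v.
- have /freeP fr : free [tuple w0; w1; w2].
    rewrite /free /= (_ : <<_>>%VS = fullv) ?dimvf //.
    by apply/vspaceP => v; rewrite memvf span.
  move=> a b c abc.
  pose e := [tuple a; b; c]; have := fr (tnth e).
  rewrite !big_ord_recl big_ord0 addr0 addrA => /(_ abc) e0.
  by split; [apply: (e0 0) | apply: (e0 1) | apply: (e0 2)].
- move=> P; split => [|[x xn0 ->]].
    rewrite piE => -[Q /dim1P[u un0 ->] <-].
    rewrite extension_line mximg_line; exists (h u).
      apply: contra_neq un0 => hu; by rewrite -(kh u) hu linear0.
    by rewrite -(fE (h u)) kh.
  rewrite -(fE x); apply: point; apply: contra_neq xn0 => kx.
  by rewrite -(hk x) kx /h map_mx0 mul0mx mxE.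
Qed.

Section Frame.
Context (pi : set {vspace 'rV[L]_3}) (w0 w1 w2 : 'rV[L]_3).
Hypothesis fr : subplane_frame pi w0 w1 w2.

Lemma frame_eq a b c a' b' c' :
  a *: w0 + b *: w1 + c *: w2 = a' *: w0 + b' *: w1 + c' *: w2 ->
  [/\ a = a', b = b' & c = c'].
Proof.
move=> /eqP; rewrite -subr_eq0 => /eqP e.
have [|/eqP + /eqP + /eqP] :=
    frame_indep fr (a := a - a') (b := b - b') (c := c - c').
  by rewrite -[RHS]e; apply/rowP => j; rewrite !mxE; ring.
by rewrite !subr_eq0 => /eqP -> /eqP -> /eqP ->.
Qed.

Lemma twist_neq0 x : x != 0 -> twist w0 w1 w2 x != 0.
Proof. by apply: contra_neq => /(frame_indep fr)[]. Qed.

Lemma line_infty_frame : line_infty L = <<[:: w1; w2]>>%VS.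
Proof.
apply/vspaceP => v; rewrite line_inftyP.
have [a [b [c vE]]] := frame_span fr v.
have -> : v 0 2 = a.
  by rewrite vE !mxE (frame0 fr) (frame1 fr) (frame2 fr) !mulr0 mulr1 !addr0.
apply/eqP/span2P => [a0|[b' [c' e]]].
  by exists b, c; rewrite vE a0 scale0r add0r.
have [|-> //] := @frame_eq a b c 0 b' c'.
by rewrite -vE e scale0r add0r.
Qed.

(** The matrix [A] sends the point of parameter [x] to some point of [pi], up
    to a factor that may depend on [x].  As in the fundamental theorem of
    projective geometry, comparing the images of 1, [x] and 1 + [x] shows that
    the factor can be taken independent of [x].  Because [A] also fixes the line
    at infinity, the first coordinate then shows that the parameter is
    multiplied by a constant [d], and the other two coordinates are multiplied
    by the conjugates of [d]. *)
Lemma stab_frame A : stab_subplane pi A ->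
  exists d0 d1 d2,
    [/\ w0 *m A = d0 *: w0, w1 *m A = d1 *: w1 & w2 *m A = d2 *: w2].
Proof.
case=> uA piA linfA.
have act x : x != 0 -> exists c y, [/\ c != 0, y != 0
    & twist w0 w1 w2 x *m A = c *: twist w0 w1 w2 y].
  move=> xn0; have : pi <[twist w0 w1 w2 x *m A]>%VS.
    rewrite -{1}piA; exists <[twist w0 w1 w2 x]>%VS; last exact: mximg_line.
    by apply/(frame_points fr); exists x.
  case/(frame_points fr) => y yn0 /vline_eqP[|c cn0 e]; first exact: twist_neq0.
  by exists c, y.
have linf v : v \in <<[:: w1; w2]>>%VS -> v *m A \in <<[:: w1; w2]>>%VS.
  by rewrite -line_infty_frame -{2}linfA => vl; apply/mximgP; exists v.
have [a00 [a01 [a02 w0A]]] := frame_span fr (w0 *m A).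
have /linf/span2P[a11 [a12 w1A]] : w1 \in <<[:: w1; w2]>>%VS.
  by apply/span2P; exists 1, 0; rewrite scale1r scale0r addr0.
have /linf/span2P[a21 [a22 w2A]] : w2 \in <<[:: w1; w2]>>%VS.
  by apply/span2P; exists 0, 1; rewrite scale1r scale0r add0r.
have twistA x : twist w0 w1 w2 x *m A = (a00 * x) *: w0 +
   (a01 * x + a11 * frob x + a21 * frob (frob x)) *: w1 +
   (a02 * x + a12 * frob x + a22 * frob (frob x)) *: w2.
  rewrite /twist !mulmxDl -!scalemxAl w0A w1A w2A.
  by apply/rowP => j; rewrite !mxE; ring.
have first_coord x c y : twist w0 w1 w2 x *m A = c *: twist w0 w1 w2 y ->
    a00 * x = c * y.
  rewrite twistA /twist => e.
  have [|-> //] := @frame_eq _ _ _ (c * y) (c * frob y) (c * frob (frob y))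
    (etrans e _).
  by rewrite !scalerDr !scalerA.
have [c1 [y1 [c1n0 y1n0 e1]]] := act 1 (oner_neq0 L).
have c1y1 := first_coord _ _ _ e1; rewrite mulr1 in c1y1.
have common x : exists y, twist w0 w1 w2 x *m A = c1 *: twist w0 w1 w2 y.
  have [xF|xnF] := pselect (exists a : F, x = a%:A).
    case: xF => a ->; exists (a *: y1).
    have tZ z : twist w0 w1 w2 (a *: z) = a%:A *: twist w0 w1 w2 z.
      have := twist_linear w0 w1 w2 a z 0; rewrite addr0 => ->.
      by rewrite /twist !rmorph0 !scale0r !addr0.
    by rewrite !tZ -scalemxAl e1 !scalerA mulrC.
  have xn0 : x != 0.
    by apply/eqP => x0; apply: xnF; exists 0; rewrite x0 scale0r.
  have x1n0 : 1 + x != 0.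
    apply/eqP => x0; apply: xnF; exists (-1).
    by rewrite scaleN1r; apply/eqP; rewrite -addr_eq0 addrC x0.
  have [c2 [y2 [c2n0 y2n0 e2]]] := act x xn0.
  have [c3 [y3 [c3n0 y3n0 e3]]] := act _ x1n0.
  have [r0 r1 r2] : [/\ c1 * y1 + c2 * y2 = c3 * y3,
      c1 * frob y1 + c2 * frob y2 = c3 * frob y3
      & c1 * frob (frob y1) + c2 * frob (frob y2) = c3 * frob (frob y3)].
    apply: frame_eq.
    have tD : twist w0 w1 w2 (1 + x) = twist w0 w1 w2 1 + twist w0 w1 w2 x.
      by rewrite -(scale1r (1 : L)) twist_linear !scale1r.
    move: e3; rewrite tD mulmxDl e1 e2 /twist => e3.
    transitivity (c3 *: (y3 *: w0 + frob y3 *: w1 + frob (frob y3) *: w2)).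
      by rewrite -e3; apply/rowP => j; rewrite !mxE; ring.
    by rewrite !scalerDr !scalerA.
  have [k1 k1E] : exists k, k = c1 / c3 by eexists.
  have [k2 k2E] : exists k, k = c2 / c3 by eexists.
  have [s0 s1 s2] : [/\ k1 * y1 + k2 * y2 = y3,
      k1 * frob y1 + k2 * frob y2 = frob y3
      & k1 * frob (frob y1) + k2 * frob (frob y2) = frob (frob y3)].
    rewrite k1E k2E; split; apply: (mulfI c3n0); rewrite -?r0 -?r1 -?r2;
      by field; exact: c3n0.
  (* Applying frob to each relation and subtracting the next one yields a
     homogeneous system for frob k1 - k1 and frob k2 - k2 whose determinant is
     a conjugate of y1 * frob y2 - frob y1 * y2. *)
  have s0' : frob k1 * frob y1 + frob k2 * frob y2 =
      k1 * frob y1 + k2 * frob y2.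
    by rewrite s1 -s0 !(rmorphD, rmorphM).
  have s1' : frob k1 * frob (frob y1) + frob k2 * frob (frob y2) =
      k1 * frob (frob y1) + k2 * frob (frob y2).
    by rewrite s2 -s1 !(rmorphD, rmorphM).
  have det0 : (frob k1 - k1) *
      (frob y1 * frob (frob y2) - frob (frob y1) * frob y2) = 0.
    transitivity (frob (frob y2) * (frob k1 * frob y1 + frob k2 * frob y2
        - (k1 * frob y1 + k2 * frob y2))
      - frob y2 * (frob k1 * frob (frob y1) + frob k2 * frob (frob y2)
        - (k1 * frob (frob y1) + k2 * frob (frob y2)))); first by ring.
    by rewrite s0' s1' !subrr !mulr0 subrr.
  (* Otherwise y1 and y2 are proportional over F, the points of parameters 1 and
     x have the same image, and x lies in F. *)
  have detn0 : y1 * frob y2 - frob y1 * y2 != 0.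
    apply/eqP => d0; apply: xnF; apply: frob_fixed.
    have [a y2E] : exists a : F, y2 / y1 = a%:A.
      apply: frob_fixed; rewrite rmorphM fmorphV.
      apply: (mulfI y1n0); apply: (mulfI (x := frob y1)).
        by rewrite fmorph_eq0.
      apply/eqP; rewrite -subr_eq0 -[X in _ == X]d0; apply/eqP; field.
      by rewrite y1n0 fmorph_eq0.
    have {}y2E : y2 = a%:A * y1 by rewrite -y2E mulfVK.
    pose r := c2 * a%:A / c1.
    have xE : twist w0 w1 w2 x = r *: twist w0 w1 w2 1.
      apply: (can_inj (mulmxK uA)).
      rewrite -scalemxAl e1 e2 y2E /r /twist !rmorphM /= !frob_alg.
      by apply/rowP => j; rewrite !mxE; field.
    have [|-> -> //] := @frame_eq x (frob x) (frob (frob x)) r r r.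
    by move: xE; rewrite /twist !rmorph1 !scale1r !scalerDr.
  have k1_fixed : frob k1 = k1.
    apply/eqP; rewrite -subr_eq0; move/eqP: det0; rewrite mulf_eq0 => /orP[//|].
    by rewrite -!rmorphM -rmorphB fmorph_eq0 (negPf detn0).
  have k2_fixed : frob k2 = k2.
    apply: (mulIf (x := frob y2)); first by rewrite fmorph_eq0.
    by move: s0'; rewrite k1_fixed => /addrI.
  have [e eE] : exists e : F, k2 / k1 = e%:A.
    by apply: frob_fixed; rewrite rmorphM fmorphV /= k1_fixed k2_fixed.
  have c2E : c2 = c1 * e%:A.
    by rewrite -eE k1E k2E; field; rewrite c1n0 c3n0.
  exists (e%:A * y2); rewrite e2 c2E /twist !rmorphM /= !frob_alg.
  by apply/rowP => j; rewrite !mxE; ring.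
pose d := y1.
have dA x : twist w0 w1 w2 x *m A = c1 *: twist w0 w1 w2 (d * x).
  have [y e] := common x; rewrite e; congr (_ *: twist _ _ _ _).
  by apply: (mulfI c1n0); rewrite -(first_coord _ _ _ e) c1y1 mulrA.
have [h0 h1 h2] : [/\ w0 *m A - (c1 * d) *: w0 = 0,
   w1 *m A - (c1 * frob d) *: w1 = 0
   & w2 *m A - (c1 * frob (frob d)) *: w2 = 0].
  apply: (twist_eq0 dimL prim_tau) => x.
  transitivity (twist w0 w1 w2 x *m A - c1 *: twist w0 w1 w2 (d * x)).
    rewrite /twist !rmorphM /= !mulmxDl -!scalemxAl.
    by apply/rowP => j; rewrite !mxE; ring.
  by rewrite dA subrr.
exists (c1 * d), (c1 * frob d), (c1 * frob (frob d)).
by split; apply/eqP; rewrite -subr_eq0 ?h0 ?h1 ?h2.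
Qed.

(** * Carriers and splash of an exterior subplane *)

Lemma fixed_span2 A (u v : 'rV[L]_3) (d e : L) : A \in unitmx ->
  u *m A = d *: u -> v *m A = e *: v ->
  mximg A <<[:: u; v]>> = <<[:: u; v]>>%VS.
Proof.
move=> uA uE vE; apply/eqP; rewrite eqEdim mximg_dim // leqnn andbT.
apply/subvP => _ /mximgP[_ /span2P[a [b ->]] ->].
apply/span2P; exists (a * d), (b * e).
by rewrite mulmxDl -!scalemxAl uE vE !scalerA.
Qed.

Lemma frame_line01 : fixed_lines pi <<[:: w0; w1]>>%VS.
Proof.
split=> [|A stA].
  apply: dim_span2 => a b e.
  have [|-> -> _] := frame_indep fr (a := a) (b := b) (c := 0).
    by rewrite scale0r addr0.
  by [].
have [d0 [d1 [d2 [e0 e1 e2]]]] := stab_frame stA.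
by case: stA => uA _ _; apply: fixed_span2 e0 e1.
Qed.

Lemma frame_line02 : fixed_lines pi <<[:: w0; w2]>>%VS.
Proof.
split=> [|A stA].
  apply: dim_span2 => a b e.
  have [|-> _ ->] := frame_indep fr (a := a) (b := 0) (c := b).
    by rewrite scale0r addr0.
  by [].
have [d0 [d1 [d2 [e0 e1 e2]]]] := stab_frame stA.
by case: stA => uA _ _; apply: fixed_span2 e0 e2.
Qed.

Lemma frame_cap01 : (line_infty L :&: <<[:: w0; w1]>>)%VS = <[w1]>%VS.
Proof.
rewrite line_infty_frame; apply/vspaceP => v; rewrite memv_cap.
apply/andP/vlineP => [[/span2P[a [b ->]] /span2P[c [d e]]]|[a ->]].
  have [|_ _ ->] := frame_eq (a := 0) (b := a) (c := b)
    (a' := c) (b' := d) (c' := 0).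
    by rewrite !scale0r add0r addr0.
  by exists a; rewrite scale0r addr0.
by split; apply/span2P; [exists a, 0 | exists 0, a];
  rewrite scale0r ?addr0 ?add0r.
Qed.

Lemma frame_cap02 : (line_infty L :&: <<[:: w0; w2]>>)%VS = <[w2]>%VS.
Proof.
rewrite line_infty_frame; apply/vspaceP => v; rewrite memv_cap.
apply/andP/vlineP => [[/span2P[a [b ->]] /span2P[c [d e]]]|[a ->]].
  have [|_ -> _] := frame_eq (a := 0) (b := a) (c := b)
    (a' := c) (b' := 0) (c' := d).
    by rewrite !scale0r add0r addr0.
  by exists b; rewrite scale0r add0r.
by split; apply/span2P; exists 0, a; rewrite scale0r add0r.
Qed.

Lemma frame_line_neq : <[w1]>%VS <> <[w2]>%VS.
Proof.
move=> e; have /vlineP[c w1E] : w1 \in <[w2]>%VS by rewrite -e memv_line.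
have [|_ /eqP + _] := frame_indep fr (a := 0) (b := 1) (c := - c);
  last by rewrite oner_eq0.
by rewrite w1E scale0r add0r scale1r scaleNr subrr.
Qed.

(** The lines [<w0, w1>] and [<w0, w2>] are fixed, and there are only three
    fixed lines. *)
Lemma carriers_frame P1 P2 : carrier_points pi P1 P2 ->
  (P1 = <[w1]>%VS /\ P2 = <[w2]>%VS) \/ (P1 = <[w2]>%VS /\ P2 = <[w1]>%VS).
Proof.
case=> m [n [_ fixE -> ->]].
have := frame_cap01; have := frame_cap02.
have := frame_line01; have := frame_line02; rewrite fixE /=.
have linf_dim : \dim (line_infty L) = 2%N.
  have [] : fixed_lines pi (line_infty L) by rewrite fixE; left; left.
  by [].
have not_linf (u : 'rV[L]_3) : (line_infty L :&: line_infty L)%VS <> <[u]>%VS.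
  rewrite capvv => e; move: linf_dim; rewrite e => d2.
  by have := dim_vline u; rewrite d2; case: (_ != 0).
case=> [[->|->]|->]; case=> [[->|->]|->] c2 c1.
all: try by case: (not_linf _ c1).
all: try by case: (not_linf _ c2).
- by case: frame_line_neq; rewrite -c1 -c2.
- by right.
- by left.
- by case: frame_line_neq; rewrite -c1 -c2.
Qed.

Lemma secant_at_infty x y :
  y *: twist w0 w1 w2 x - x *: twist w0 w1 w2 y =
  (y * frob x - x * frob y) *: w1
    - frob (frob (y * frob x - x * frob y)) *: w2.
Proof.
rewrite /twist !(rmorphB, rmorphM) /= !(frob3 dimL).
by apply/rowP => j; rewrite !mxE; ring.
Qed.

(** The secant of [pi] through the points of parameters [x] and [y] meets the
    line at infinity in [<w1 - b *: w2>] with [b] the quotient of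
    [frob (frob w)] by [w], where [w = y * frob x - x * frob y], and such a
    quotient has norm one.

    Conversely a secant has an equation with conjugate coefficients
    [t], [frob t], [frob (frob t)], and passes through [<w1 - b *: w2>] when
    [frob t = b * frob (frob t)], which is solvable by [hilbert90] (with
    [s = frob t]).  Two points on it are obtained by dividing by [t] the
    elements [tau - frob tau] and [tau ^+ 2 - frob tau ^+ 2] of trace zero;
    their [w] is the Vandermonde product of the conjugates of [tau], which is
    fixed by [frob], divided by [t * frob t]. *)
Lemma splash_frame P : splash pi P <->
  exists2 b, norm3 b = 1 & P = <[w1 - b *: w2]>%VS.
Proof.
split=> [[/dim1P[v vn0 ->] vl [l [ldim [Q [R [piQ piR QR Ql Rl]]]] Pl]]|].
  case/(frame_points fr): piQ QR Ql => x xn0 ->.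
  case/(frame_points fr): piR Rl => y yn0 ->.
  rewrite -!memvE => Rl QR Ql.
  have lE : <<[:: twist w0 w1 w2 x; twist w0 w1 w2 y]>>%VS = l.
    apply/eqP; rewrite eqEdim ldim dim_span2 ?leqnn ?andbT.
      by apply/span_subvP => z; rewrite !inE => /orP[] /eqP ->.
    move=> a b e; have [b0|bn0] := eqVneq b 0.
      split=> //; move/eqP: e; rewrite b0 scale0r addr0 scaler_eq0.
      by rewrite (negPf (twist_neq0 xn0)) orbF => /eqP.
    case: QR; apply/eqP; have [a0|an0] := eqVneq a 0.
      move/eqP: e; rewrite a0 scale0r add0r scaler_eq0.
      by rewrite (negPf (twist_neq0 yn0)) orbF (negPf bn0).
    rewrite -(vlineZ _ an0).
    rewrite -(vlineZ (twist w0 w1 w2 y) (c := - b)) ?oppr_eq0 //.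
    by apply/eqP; congr (<[_]>%VS); apply/eqP; rewrite scaleNr -addr_eq0 e.
  have : v \in l by rewrite memvE.
  rewrite -lE => /span2P[a [b vE]].
  have [c] : exists c, v = c *: (y *: twist w0 w1 w2 x - x *: twist w0 w1 w2 y).
    have axby : a * x + b * y = 0.
      move: vl; rewrite -memvE line_infty_frame => /span2P[c [d e]].
      have [|-> //] := frame_eq (a := a * x + b * y)
        (b := a * frob x + b * frob y)
        (c := a * frob (frob x) + b * frob (frob y))
        (a' := 0) (b' := c) (c' := d).
      rewrite scale0r add0r -e vE /twist.
      by apply/rowP => j; rewrite !mxE; ring.
    exists (- b / x); rewrite vE scalerBr !scalerA mulfVK // scaleNr opprK.
    congr (_ *: _ + _); apply: (mulIf xn0).
    rewrite -[RHS](_ : - b * y = _); last by field.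
    by apply/eqP; rewrite mulNr -addr_eq0 axby.
  rewrite secant_at_infty; set w := y * frob x - x * frob y => {vE}vE.
  have wn0 : w != 0.
    apply: contra_neq vn0 => w0'.
    by rewrite vE w0' !rmorph0 !scale0r subrr scaler0.
  exists (frob (frob w) / w).
    rewrite norm3M norm3V !(norm3_frob dimL) divff //.
    by rewrite /norm3 !mulf_neq0 ?fmorph_eq0.
  move: vn0; rewrite vE.
  have -> : w *: w1 - frob (frob w) *: w2 =
      w *: (w1 - (frob (frob w) / w) *: w2).
    by rewrite scalerBr scalerA mulrC mulfVK.
  rewrite scalerA => cwn0; apply: vlineZ.
  by apply: contra_neq cwn0 => ->; apply: scale0r.
case=> b Nb PE; have [s sn0 sE] := hilbert90 dimL prim_tau Nb.
(* In the notation above, t is s2. *)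
pose s2 := frob (frob s); have s2n0 : s2 != 0 by rewrite !fmorph_eq0.
have fs2 : frob s2 = s by rewrite /s2 frob3.
have s1n0 : frob s != 0 by rewrite fmorph_eq0.
have [x xE] : exists x, x = (tau - frob tau) / s2 by eexists.
have [y yE] : exists y, y = (tau * tau - frob tau * frob tau) / s2 by eexists.
have tau01 := frob_tau01 dimL prim_tau.
have tau12 := frob_tau12 dimL prim_tau; have tau20 := frob_tau20 dimL prim_tau.
have xn0 : x != 0 by rewrite xE mulf_neq0 ?invr_eq0.
pose w := y * frob x - x * frob y.
have wE : w = (tau - frob tau) * (frob tau - frob (frob tau)) *
    (tau - frob (frob tau)) / (s2 * s).
  rewrite /w xE yE !(rmorphM, rmorphB, fmorphV) /= fs2.
  by field; rewrite s2n0 sn0.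
have tau02 : tau - frob (frob tau) != 0 by rewrite -opprB oppr_eq0.
have wn0 : w != 0 by rewrite wE !mulf_neq0 ?invr_eq0 ?mulf_neq0.
have w2E : frob (frob w) = b * w.
  rewrite wE (_ : b = s / frob s); last by rewrite -{1}sE mulfK.
  rewrite !(rmorphM, rmorphB, fmorphV) /= !(frob3 dimL) -/s2.
  by field; rewrite s2n0 sn0 s1n0.
have yn0 : y != 0.
  apply: contra_neq wn0 => y0.
  by rewrite /w y0 !rmorph0 mul0r mulr0 subrr.
have w12n0 : w1 - b *: w2 != 0.
  apply/eqP => e.
  have [|_ /eqP + _] := frame_indep fr (a := 0) (b := 1) (c := - b);
    last by rewrite oner_eq0.
  by rewrite scale0r add0r scale1r scaleNr e.
have indep a c :
    a *: twist w0 w1 w2 x + c *: twist w0 w1 w2 y = 0 -> a = 0 /\ c = 0.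
  move=> e.
  have [|h0 h1 _] := frame_indep fr (a := a * x + c * y)
      (b := a * frob x + c * frob y)
      (c := a * frob (frob x) + c * frob (frob y)).
    by rewrite -[RHS]e /twist; apply/rowP => j; rewrite !mxE; ring.
  split; apply: (mulIf wn0); rewrite mul0r.
    transitivity (y * (a * frob x + c * frob y) - frob y * (a * x + c * y)).
      by rewrite /w; ring.
    by rewrite h0 h1 !mulr0 subrr.
  transitivity (frob x * (a * x + c * y) - x * (a * frob x + c * frob y)).
    by rewrite /w; ring.
  by rewrite h0 h1 !mulr0 subrr.
rewrite PE; split; first by rewrite dim_vline w12n0.
  rewrite -memvE line_infty_frame; apply/span2P; exists 1, (- b).
  by rewrite scale1r scaleNr.
exists <<[:: twist w0 w1 w2 x; twist w0 w1 w2 y]>>%VS; last first.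
  rewrite -memvE; apply/span2P; exists (y / w), (- x / w).
  rewrite -[LHS](scalerK wn0) scalerBr scalerA [w * b]mulrC -w2E.
  rewrite -secant_at_infty.
  by apply/rowP => j; rewrite !mxE; ring.
split; first exact: dim_span2.
exists <[twist w0 w1 w2 x]>%VS, <[twist w0 w1 w2 y]>%VS; split.
- by apply/(frame_points fr); exists x.
- by apply/(frame_points fr); exists y.
- case/vline_eqP; first exact: twist_neq0 yn0.
  move=> c _ e; have [|/eqP + _] := indep 1 (- c); last by rewrite oner_eq0.
  by rewrite scale1r scaleNr e subrr.
- by rewrite -memvE; apply/span2P; exists 1, 0; rewrite scale1r scale0r addr0.
- by rewrite -memvE; apply/span2P; exists 0, 1; rewrite scale1r scale0r add0r.
Qed.

End Frame.

End Subplane.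

(** * Linear maps meeting every multiplication of norm one *)

Section Core.
Context (F : finFieldType) (L : fieldExtType F).
Hypothesis dimL : \dim {:L} = 3%N.
Variable tau : L.
Hypothesis prim_tau : primitive_element tau.

Lemma linear_comb_frob (f : L -> L) :
  (forall (a : F) x y, f (a *: x + y) = a *: f x + f y) ->
  exists a b c, forall x, f x = a * x + b * frob x + c * frob (frob x).
Proof.
move=> flin.
have [|e0 [e1 [e2 fE]]] :=
    linear_twist dimL prim_tau (f := fun x => const_mx (f x) : 'rV_1).
  by move=> a x y; apply/rowP => j; rewrite !mxE flin mulr_algl.
exists (e0 0 0), (e1 0 0), (e2 0 0) => x.
have := congr1 (fun v : 'rV_1 => v 0 0) (fE x); rewrite /twist !mxE => ->.
by ring.
Qed.

(** The left-hand side is the Dickson determinant: the three conjugates of the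
    equation form a linear system in the conjugates of [x]. *)
Lemma dickson_det (a b c x : L) : x != 0 ->
  a * x + b * frob x + c * frob (frob x) = 0 ->
  norm3 a + norm3 b + norm3 c - a * (frob b * frob (frob c))
    - frob a * (frob (frob b) * c) - frob (frob a) * (b * frob c) = 0.
Proof.
move=> xn0 e0.
have frob0 (y : L) : y = 0 -> frob y = 0 by move=> ->; rewrite rmorph0.
have e1 := frob0 _ e0; have e2 := frob0 _ e1.
rewrite !(rmorphD, rmorphM) /= !(frob3 dimL) in e2.
rewrite !(rmorphD, rmorphM) /= !(frob3 dimL) in e1.
apply: (mulIf xn0); rewrite mul0r /norm3.
(* The multipliers are the cofactors of the first column. *)
transitivity ((frob a * frob (frob a) - frob b * frob (frob c)) *
    (a * x + b * frob x + c * frob (frob x))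
  + (c * frob (frob c) - b * frob (frob a)) *
    (frob a * frob x + frob b * frob (frob x) + frob c * x)
  + (b * frob b - frob a * c) *
    (frob (frob a) * frob (frob x) + frob (frob b) * x
       + frob (frob c) * frob x)).
  by ring.
by rewrite e0 e1 e2 !mulr0 !addr0.
Qed.

(** The Dickson determinant of the map minus [d] vanishes for each [d] of norm
    one; [norm1_poly_eq0] reads off its coefficients of [1], [d] and
    [d * frob d]. *)
Lemma singular_all_norm1 (a b c : L) :
  (forall d, norm3 d = 1 -> exists2 x, x != 0 &
     a * x + b * frob x + c * frob (frob x) = d * x) ->
  a = 0 /\ (norm3 b = 1 /\ c = 0 \/ b = 0 /\ norm3 c = 1).
Proof.
move=> h.
have [k0 u0 v0] : [/\ norm3 a + norm3 b + norm3 c - a * (frob b * frob (frob c))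
    - frob a * (frob (frob b) * c) - frob (frob a) * (b * frob c) - 1 = 0,
   frob b * frob (frob c) - frob a * frob (frob a) = 0 & frob (frob a) = 0].
  apply: (norm1_poly_eq0 dimL prim_tau
    (u1 := frob (frob b) * c - a * frob (frob a))
    (u2 := b * frob c - a * frob a) (v1 := a) (v2 := frob a)) => d Nd.
  have [x xn0 e] := h d Nd.
  have sing : (a - d) * x + b * frob x + c * frob (frob x) = 0.
    by move/eqP: e; rewrite -subr_eq0 => /eqP e; rewrite -[RHS]e; ring.
  rewrite -[RHS](dickson_det xn0 sing).
  (* The coefficient - norm3 d of the determinant is the constant - 1. *)
  by rewrite -[X in _ - X + _ + _ + _ + _ + _ + _]Nd /norm3 !rmorphB /=; ring.
have a0 : a = 0 by rewrite -(frob3 dimL a) v0 rmorph0.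
split=> //; move: k0 u0; rewrite a0 /norm3 !rmorph0 !mul0r !subr0 add0r.
move=> k0 /eqP; rewrite mulf_eq0 !fmorph_eq0.
case/orP=> /eqP e0; [right|left]; split=> //.
  by apply/eqP; rewrite -subr_eq0 -[X in _ == X]k0 e0 !mul0r add0r.
by apply/eqP; rewrite -subr_eq0 -[X in _ == X]k0 e0 !mul0r addr0.
Qed.

(** * Covers of the splash in the coordinates L + L *)

Section Coordinates.
Variables A B : 'Hom(L, 'rV[F]_6).
Hypothesis AB_inj : forall x y, A x + B y = 0 -> x = 0 /\ y = 0.

Lemma AB_eq x y x' y' : A x + B y = A x' + B y' -> x = x' /\ y = y'.
Proof.
move=> e; have [|/eqP + /eqP +] := AB_inj (x := x - x') (y := y - y').
  by rewrite !linearB addrACA -opprD e subrr.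
by rewrite !subr_eq0 => /eqP -> /eqP ->.
Qed.

Lemma AB_complement (W : {vspace 'rV[F]_6}) :
  (forall y, B y \in W -> y = 0) -> \dim W = 3%N -> (W + limg B)%VS = fullv.
Proof.
move=> WB dW; apply/eqP; rewrite eqEdim subvf dimvf /=.
rewrite dimv_disjoint_sum ?dW ?limg_dim_eq ?dimL //.
  apply/eqP; rewrite -subv0; apply/subvP => y.
  rewrite memv_cap memv_ker memvf /=.
  move=> /eqP By0; rewrite memv0; apply/eqP/WB; by rewrite By0 mem0v.
apply/eqP; rewrite -subv0; apply/subvP => u; rewrite memv_cap memv0.
by case/andP=> uW /memv_imgP[y _ uE]; rewrite uE (WB y) ?linear0 -?uE.
Qed.

Lemma AB_surj u : exists x y, u = A x + B y.
Proof.
have : u \in (limg A + limg B)%VS.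
  rewrite AB_complement ?memvf // => [y /memv_imgP[x _ e]|].
    by have [|_ //] := @AB_eq 0 y x 0; rewrite !linear0 add0r addr0.
  rewrite limg_dim_eq // ; apply/eqP; rewrite -subv0; apply/subvP => x.
  rewrite memv_cap memv_ker memvf memv0 => /= /eqP Ax0.
  by have [|-> _] := @AB_inj x 0; rewrite // Ax0 linear0 addr0.
case/memv_addP => _ /memv_imgP[x _ ->] [_ /memv_imgP[y _ ->] ->].
by exists x, y.
Qed.

Definition param (U : {vspace 'rV[F]_6}) (g : L -> 'rV[F]_6) :=
  forall u, u \in U <-> exists x, u = g x.

Lemma param_inj U W g : param U g -> param W g -> U = W.
Proof.
move=> gU gW; apply/vspaceP => u.
by apply/idP/idP => [/(gU u)/(gW u)|/(gW u)/(gU u)].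
Qed.

Lemma param_graph_exists (f : L -> L) (f_lin : linear f) :
  exists U, param U (fun x => A x + B (f x)).
Proof.
pose f' : {linear L -> L} := HB.pack f (GRing.isLinear.Build F _ _ _ f f_lin).
pose g := (A + (B \o linfun f'))%VF.
exists (limg g) => u; split => [/memv_imgP[x _ ->]|[x ->]].
  by exists x; rewrite /g add_lfunE comp_lfunE lfunE.
apply/memv_imgP; exists x; rewrite ?memvf //.
by rewrite /g add_lfunE comp_lfunE lfunE.
Qed.

End Coordinates.

Section Covers.
Variables A B : 'Hom(L, 'rV[F]_6).
Hypothesis AB_inj : forall x y, A x + B y = 0 -> x = 0 /\ y = 0.
Variables SS C : set {vspace 'rV[F]_6}.
Hypothesis SSP : forall U, SS U <->
  exists2 b, norm3 b = 1 & param U (fun x => A x + B (b * x)).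
Hypothesis coverC : cover_size_set C.
Hypothesis switchC : switching SS C.

Lemma cover_plane_disjoint U y : C U -> B y \in U -> y = 0.
Proof.
move=> CU ByU; apply/eqP/negPn/negP => yn0.
have Byn0 : B y != 0.
  apply: contra_neq yn0 => By0; have [|_ //] := AB_inj (x := 0) (y := y).
  by rewrite By0 linear0 addr0.
have : points_of C <[B y]>%VS.
  by split; [rewrite dim_vline Byn0 | exists U; rewrite -?memvE].
case: switchC => <- _ [_ [W /SSP[b Nb WP]]]; rewrite -memvE => /WP[x e].
have [|x0 y0] := AB_eq AB_inj (x := 0) (y := y) (x' := x) (y' := b * x).
  by rewrite linear0 add0r.
by case/eqP: yn0; rewrite y0 -x0 mulr0.
Qed.

(** The plane [U] is complementary to the plane of the [B y], hence a graph over
    the plane of the [A x]. *)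
Lemma cover_plane_graph U : C U ->
  exists2 f : L -> L, (forall (a : F) x y, f (a *: x + y) = a *: f x + f y) &
    param U (fun x => A x + B (f x)).
Proof.
move=> CU; have [_ dimC _] := coverC.
have UB := cover_plane_disjoint CU.
have /choice[f fU] : forall x, exists y, A x + B y \in U.
  move=> x.
  have : A x \in (U + limg B)%VS by rewrite AB_complement ?memvf // dimC.
  case/memv_addP => u uU [_ /memv_imgP[y _ ->] e].
  by exists (- y); rewrite linearN e addrK.
have f_uniq x y : A x + B y \in U -> y = f x.
  move=> yU; apply/eqP; rewrite -subr_eq0; apply/eqP/UB.
  have -> : B (y - f x) = A x + B y - (A x + B (f x)).
    by rewrite linearB opprD addrACA subrr add0r.
  by rewrite memvB.
exists f => [a x y|u].
  apply/esym/f_uniq; rewrite !linearP.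
  have -> : a *: A x + A y + (a *: B (f x) + B (f y)) =
     a *: (A x + B (f x)) + (A y + B (f y)) by rewrite scalerDr addrACA.
  by rewrite memvD ?memvZ.
split=> [uU|[x ->] //]; have [x [y uE]] := AB_surj AB_inj u.
by exists x; rewrite uE -(f_uniq x y) // -uE.
Qed.

Definition twisted1 U :=
  exists2 b, norm3 b = 1 & param U (fun x => A x + B (b * frob x)).
Definition twisted2 U :=
  exists2 b, norm3 b = 1 & param U (fun x => A x + B (b * frob (frob x))).

(** A common point of [U] and the splash plane of slope [d] is a nonzero [x]
    with [f x = d * x], so [singular_all_norm1] applies to [f]. *)
Lemma cover_plane_twisted U : C U -> twisted1 U \/ twisted2 U.
Proof.
move=> CU; have [f flin fP] := cover_plane_graph CU.
have [a [b [c fE]]] := linear_comb_frob flin.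
have [|a0 bc] := singular_all_norm1 (a := a) (b := b) (c := c).
  move=> d Nd; have mul_lin : linear (fun x : L => d * x).
    by move=> k x y; rewrite mulrDr scalerAr.
  have [W WP] := param_graph_exists A B mul_lin.
  have SSW : SS W by apply/SSP; exists d.
  case: switchC => _ /(_ _ _ SSW CU) /dim1P[v vn0 WU].
  have : v \in (W :&: U)%VS by rewrite WU memv_line.
  rewrite memv_cap => /andP[/WP[x xE] /fP[y yE]].
  have [|xy e] := AB_eq AB_inj (x := x) (y := d * x) (x' := y) (y' := f y).
    by rewrite -xE -yE.
  exists x; last by rewrite -fE e xy.
  by apply: contra_neq vn0 => x0; rewrite xE x0 mulr0 !linear0 addr0.
case: bc => -[h1 h2]; [left; exists b => // u | right; exists c => // u];
  split=> [/fP[x ->]|[x ->]];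
  [exists x|apply/fP; exists x|exists x|apply/fP; exists x];
  by rewrite fE a0 ?h1 ?h2 !mul0r ?add0r ?addr0.
Qed.

(** By [hilbert90] the graphs of [b * frob x] and [c * frob (frob x)] share a
    point as soon as [b] and [c] have the same norm, whereas the planes of a
    cover are disjoint. *)
Lemma cover_homogeneous :
  (forall U, C U -> twisted1 U) \/ (forall U, C U -> twisted2 U).
Proof.
have [all1|] := pselect (forall U, C U -> twisted1 U); first by left.
case/existsNP => U0 /not_implyP[CU0 not1]; right => U CU.
have [t1|//] := cover_plane_twisted CU.
have [//|[c Nc U0P]] := cover_plane_twisted CU0.
case: t1 => b Nb UP; exfalso.
have UU0 : U <> U0 by move=> e; apply: not1; rewrite -e; exists b.
case: coverC => _ _ /(_ _ _ CU CU0 UU0) []; apply/intersectsP.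
have [|t tn0 tE] := hilbert90 dimL prim_tau (b := c / b).
  by rewrite norm3M norm3V Nb Nc divr1.
pose x := frob (frob t).
have fx : frob x = t by rewrite /x (frob3 dimL).
exists (A x + B (b * frob x)); split.
- apply: contra_neq tn0 => /AB_inj[_ /eqP].
  by rewrite mulf_eq0 fx (negPf (norm3_neq0 Nb)) => /eqP.
- by apply/UP; exists x.
apply/U0P; exists x; rewrite !fx; congr (_ + B _).
by rewrite -{1}tE; field; apply: norm3_neq0.
Qed.

End Covers.

(** * Transversal lines over L *)

Section Transversals.

Definition indep6 (K : fieldType) (V : vectType K) (a0 a1 a2 b0 b1 b2 : V) :=
  forall r0 r1 r2 s0 s1 s2 : K,
    r0 *: a0 + r1 *: a1 + r2 *: a2 + (s0 *: b0 + s1 *: b1 + s2 *: b2) = 0 ->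
    [/\ r0 = 0, r1 = 0 & r2 = 0] /\ [/\ s0 = 0, s1 = 0 & s2 = 0].

Lemma indep6_rot (K : fieldType) (V : vectType K) (a0 a1 a2 b0 b1 b2 : V) :
  indep6 a0 a1 a2 b0 b1 b2 -> indep6 a0 a1 a2 b1 b2 b0.
Proof.
move=> i6 r0 r1 r2 s0 s1 s2 e.
have [|[-> -> ->] [-> -> ->] //] := i6 r0 r1 r2 s2 s0 s1.
by rewrite -[RHS]e; congr (_ + _); rewrite -addrA addrC.
Qed.

Lemma extension_param (U : {vspace 'rV[F]_6}) (g : L -> 'rV[F]_6)
    (h0 h1 h2 : 'rV[L]_6) :
  param U g -> (forall x, map_mx (in_alg L) (g x) = twist h0 h1 h2 x) ->
  [/\ h0 \in extension L U, h1 \in extension L U & h2 \in extension L U]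
  /\ (extension L U <= <<[:: h0; h1; h2]>>)%VS.
Proof.
move=> UP gE; split.
  apply: (twist_span dimL prim_tau) => x.
  by rewrite -gE mem_extension //; apply/UP; exists x.
apply: extension_sub => u /UP[x ->]; rewrite gE.
by apply/span3P; exists x, (frob x), (frob (frob x)).
Qed.

Lemma indep6_neq0 (K : fieldType) (V : vectType K) (a0 a1 a2 b0 b1 b2 : V) :
  indep6 a0 a1 a2 b0 b1 b2 ->
  all (fun v => v != 0) [:: a0; a1; a2] /\
  all (fun v => v != 0) [:: b0; b1; b2].
Proof.
move=> i6; split; apply/and4P; split=> //; apply/eqP => e.
- have [|[/eqP + _ _] _] := i6 1 0 0 0 0 0; last by rewrite oner_eq0.
  by rewrite e scaler0 !scale0r !addr0.
- have [|[_ /eqP + _] _] := i6 0 1 0 0 0 0; last by rewrite oner_eq0.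
  by rewrite e scaler0 !scale0r !addr0.
- have [|[_ _ /eqP +] _] := i6 0 0 1 0 0 0; last by rewrite oner_eq0.
  by rewrite e scaler0 !scale0r !addr0.
- have [|_ [/eqP + _ _]] := i6 0 0 0 1 0 0; last by rewrite oner_eq0.
  by rewrite e scaler0 !scale0r !addr0.
- have [|_ [_ /eqP + _]] := i6 0 0 0 0 1 0; last by rewrite oner_eq0.
  by rewrite e scaler0 !scale0r !addr0.
- have [|_ [_ _ /eqP +]] := i6 0 0 0 0 0 1; last by rewrite oner_eq0.
  by rewrite e scaler0 !scale0r !addr0.
Qed.

(** Each extended plane has a point on each line [<ai, bi>], and three distinct
    transversal lines exhaust a triple. *)
Lemma transversal_triple_lines (X : set {vspace 'rV[F]_6})
    (g : {vspace 'rV[L]_6})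
    (a0 a1 a2 b0 b1 b2 : 'rV[L]_6) :
  indep6 a0 a1 a2 b0 b1 b2 -> transversal_triple X g ->
  (forall U, X U -> exists c0 c1 c2, [/\ a0 + c0 *: b0 \in extension L U,
     a1 + c1 *: b1 \in extension L U & a2 + c2 *: b2 \in extension L U]) ->
  conjugate_triple g =
    [set <<[:: a0; b0]>>%VS; <<[:: a1; b1]>>%VS; <<[:: a2; b2]>>%VS].
Proof.
move=> i6 trX XU.
have mem_l (u v : 'rV[L]_6) : u \in <<[:: u; v]>>%VS.
  by apply/span2P; exists 1, 0; rewrite scale1r scale0r addr0.
have t0 : transversal_line X <<[:: a0; b0]>>%VS.
  split=> [|U /XU[c0 [c1 [c2 [h0 _ _]]]]].
    apply: dim_span2 => r s e; have [|[-> _ _] [-> _ _] //] := i6 r 0 0 s 0 0.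
    by rewrite !scale0r !addr0.
  apply/intersectsP; exists (a0 + c0 *: b0); split => //.
    apply/eqP => e.
    have [|[/eqP + _ _] _] := i6 1 0 0 c0 0 0; last by rewrite oner_eq0.
    by rewrite !scale0r !addr0 scale1r.
  by apply/span2P; exists 1, c0; rewrite scale1r.
have t1 : transversal_line X <<[:: a1; b1]>>%VS.
  split=> [|U /XU[c0 [c1 [c2 [_ h1 _]]]]].
    apply: dim_span2 => r s e; have [|[_ -> _] [_ -> _] //] := i6 0 r 0 0 s 0.
    by rewrite !scale0r !addr0 !add0r.
  apply/intersectsP; exists (a1 + c1 *: b1); split => //.
    apply/eqP => e.
    have [|[_ /eqP + _] _] := i6 0 1 0 0 c1 0; last by rewrite oner_eq0.
    by rewrite !scale0r !addr0 !add0r scale1r.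
  by apply/span2P; exists 1, c1; rewrite scale1r.
have t2 : transversal_line X <<[:: a2; b2]>>%VS.
  split=> [|U /XU[c0 [c1 [c2 [_ _ h2]]]]].
    apply: dim_span2 => r s e; have [|[_ _ ->] [_ _ ->] //] := i6 0 0 r 0 0 s.
    by rewrite !scale0r !add0r.
  apply/intersectsP; exists (a2 + c2 *: b2); split => //.
    apply/eqP => e.
    have [|[_ _ /eqP +] _] := i6 0 0 1 0 0 c2; last by rewrite oner_eq0.
    by rewrite !scale0r !add0r scale1r.
  by apply/span2P; exists 1, c2; rewrite scale1r.
have n01 : <<[:: a0; b0]>>%VS <> <<[:: a1; b1]>>%VS.
  move=> e; have := mem_l a0 b0; rewrite e => /span2P[r [s a0E]].
  have [|[/eqP + _ _] _] := i6 1 (- r) 0 0 (- s) 0; last by rewrite oner_eq0.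
  by rewrite a0E !scale0r scale1r !addr0 add0r !scaleNr addrAC addrK subrr.
have n12 : <<[:: a1; b1]>>%VS <> <<[:: a2; b2]>>%VS.
  move=> e; have := mem_l a1 b1; rewrite e => /span2P[r [s a1E]].
  have [|[_ /eqP + _] _] := i6 0 1 (- r) 0 0 (- s); last by rewrite oner_eq0.
  by rewrite a1E !scale0r scale1r !add0r !scaleNr addrAC addrK subrr.
have n20 : <<[:: a2; b2]>>%VS <> <<[:: a0; b0]>>%VS.
  move=> e; have := mem_l a2 b2; rewrite e => /span2P[r [s a2E]].
  have [|[_ _ /eqP +] _] := i6 (- r) 0 1 (- s) 0 0; last by rewrite oner_eq0.
  rewrite a2E !scale0r scale1r !addr0 !scaleNr [- _ + _]addrC.
  by rewrite addrAC addrK subrr.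
have : conjugate_triple g <<[:: a0; b0]>>%VS by rewrite -trX.
have : conjugate_triple g <<[:: a1; b1]>>%VS by rewrite -trX.
have : conjugate_triple g <<[:: a2; b2]>>%VS by rewrite -trX.
move: n01 n12 n20; rewrite /conjugate_triple /=.
move: <<[:: a0; b0]>>%VS <<[:: a1; b1]>>%VS <<[:: a2; b2]>>%VS => l0 l1 l2.
move: (conjugate g) (conjugate (conjugate g)) => g1 g2 n01 n12 n20.
case=> [[] e2|e2]; case=> [[] e1|e1]; case=> [[] e0|e0]; try congruence.
all: by rewrite e0 e1 e2; apply/seteqP; split=> h /= [[->|->]|->]; auto.
Qed.

End Transversals.

Section CarriersMeet.
Variables A B : 'Hom(L, 'rV[F]_6).
Hypothesis AB_inj : forall x y, A x + B y = 0 -> x = 0 /\ y = 0.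
Let iota := map_mx (in_alg L) : 'rV[F]_6 -> 'rV[L]_6.

(** The rational vectors span the whole space over L, and they all lie in the
    span of the six coefficient vectors, which therefore form a basis. *)
Lemma twisted_coordinates : exists e0 e1 e2 f0 f1 f2,
  [/\ forall x, iota (A x) = twist e0 e1 e2 x,
      forall y, iota (B y) = twist f0 f1 f2 y & indep6 e0 e1 e2 f0 f1 f2].
Proof.
have lin (D : 'Hom(L, 'rV[F]_6)) :
    exists d0 d1 d2, forall x, iota (D x) = twist d0 d1 d2 x.
  apply: (linear_twist dimL prim_tau) => a x y.
  by rewrite linearP /iota map_algZD.
have [e0 [e1 [e2 eE]]] := lin A; have [f0 [f1 [f2 fE]]] := lin B.
exists e0, e1, e2, f0, f1, f2; split=> //.
set X := [tuple e0; e1; e2; f0; f1; f2].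
have twistX D (d0 d1 d2 : 'rV[L]_6) x : {subset [:: d0; d1; d2] <= X} ->
    iota (D x) = twist d0 d1 d2 x -> iota (D x) \in <<X>>%VS.
  move=> sub ->; have mem d : d \in [:: d0; d1; d2] -> d \in <<X>>%VS.
    by move/sub; apply: memv_span.
  by rewrite /twist !memvD ?memvZ // mem // !inE eqxx ?orbT.
have freeX : free X.
  rewrite /free /= (_ : <<_>>%VS = fullv) ?dimvf //.
  apply/vspaceP => v; rewrite memvf [v]row_sum_delta rpred_sum // => j _.
  rewrite memvZ // -(map_delta_mx (in_alg L)).
  have [x [y ->]] := AB_surj AB_inj (delta_mx 0 j).
  rewrite map_mxD memvD //.
    apply: twistX (eE x) => d; rewrite !inE.
    by case/or3P=> /eqP ->; rewrite eqxx ?orbT.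
  apply: twistX (fE y) => d; rewrite !inE.
  by case/or3P=> /eqP ->; rewrite eqxx ?orbT.
move=> r0 r1 r2 s0 s1 s2 e.
have := (freeP freeX) (tnth [tuple r0; r1; r2; s0; s1; s2]).
rewrite !big_ord_recl big_ord0 /= => /(_ _) h.
have {}h : forall i : 'I_6, tnth [tuple r0; r1; r2; s0; s1; s2] i = 0.
  apply: h; rewrite -[RHS]e /= addr0 !addrA //.
split; split.
- exact: (h 0).
- exact: (h 1).
- exact: (h 2).
- exact: (h 3).
- exact: (h 4).
- exact: (h 5).
Qed.

Section Lines.
Context (e0 e1 e2 f0 f1 f2 : 'rV[L]_6).
Hypothesis eE : forall x, iota (A x) = twist e0 e1 e2 x.
Hypothesis fE : forall y, iota (B y) = twist f0 f1 f2 y.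
Hypothesis ef_indep : indep6 e0 e1 e2 f0 f1 f2.

Lemma splash_transversals SS g :
  (forall U, SS U ->
     exists2 b, norm3 b = 1 & param U (fun x => A x + B (b * x))) ->
  transversal_triple SS g ->
  conjugate_triple g =
    [set <<[:: e0; f0]>>%VS; <<[:: e1; f1]>>%VS; <<[:: e2; f2]>>%VS].
Proof.
move=> SSP trS; apply: transversal_triple_lines trS _ => // U /SSP[b Nb UP].
exists b, (frob b), (frob (frob b)).
have [|h _] := extension_param (h0 := e0 + b *: f0) (h1 := e1 + frob b *: f1)
  (h2 := e2 + frob (frob b) *: f2) UP; last exact: h.
move=> x; rewrite map_mxD [map_mx _ _]eE [map_mx _ (B _)]fE.
rewrite /twist !rmorphM /=.
by apply/rowP => j; rewrite !mxE; ring.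
Qed.

(** Over L, the graph of [b * frob x] is spanned by [e1 + b *: f0] and its
    conjugates, that of [b * frob (frob x)] by [e2 + b *: f0] and its
    conjugates. *)
Lemma cover_transversals C g :
  (forall U, C U -> twisted1 A B U) \/ (forall U, C U -> twisted2 A B U) ->
  transversal_triple C g ->
  conjugate_triple g =
    [set <<[:: e0; f2]>>%VS; <<[:: e1; f0]>>%VS; <<[:: e2; f1]>>%VS] \/
  conjugate_triple g =
    [set <<[:: e0; f1]>>%VS; <<[:: e1; f2]>>%VS; <<[:: e2; f0]>>%VS].
Proof.
move=> hom trC; case: hom => tw; [left|right].
- apply: transversal_triple_lines trC _ => [|U /tw[b Nb UP]].
    exact/indep6_rot/indep6_rot.
  exists (frob (frob b)), b, (frob b).
  have [|h _] := extension_param (h0 := e0 + frob (frob b) *: f2)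
    (h1 := e1 + b *: f0) (h2 := e2 + frob b *: f1) UP; last exact: h.
  move=> x; rewrite map_mxD [map_mx _ _]eE [map_mx _ (B _)]fE.
  rewrite /twist !rmorphM /= (frob3 dimL).
  by apply/rowP => j; rewrite !mxE; ring.
- apply: transversal_triple_lines trC _ => [|U /tw[b Nb UP]].
    exact/indep6_rot.
  exists (frob b), (frob (frob b)), b.
  have [|h _] := extension_param (h0 := e0 + frob b *: f1)
    (h1 := e1 + frob (frob b) *: f2) (h2 := e2 + b *: f0) UP; last exact: h.
  move=> x; rewrite map_mxD [map_mx _ _]eE [map_mx _ (B _)]fE.
  rewrite /twist !rmorphM /= !(frob3 dimL).
  by apply/rowP => j; rewrite !mxE; ring.
Qed.

(** Each kind of cover has one of these two lines among its transversals, so a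
    single line already excludes every spread plane but the two axes. *)
Lemma spread_plane_skew (a b : L) U : a != 0 -> b != 0 ->
  param U (fun x => A (a * x) + B (b * x)) ->
  ~ intersects (extension L U) <<[:: e0; f1]>>%VS /\
  ~ intersects (extension L U) <<[:: e0; f2]>>%VS.
Proof.
move=> an0 bn0 UP.
have [|_ /subvP extU] := extension_param (h0 := a *: e0 + b *: f0)
  (h1 := frob a *: e1 + frob b *: f1)
  (h2 := frob (frob a) *: e2 + frob (frob b) *: f2) UP.
  move=> x; rewrite map_mxD [map_mx _ _]eE [map_mx _ (B _)]fE.
  rewrite /twist !rmorphM /=.
  by apply/rowP => j; rewrite !mxE; ring.
have only0 r s t p q q' :
    r *: (a *: e0 + b *: f0) + s *: (frob a *: e1 + frob b *: f1)
      + t *: (frob (frob a) *: e2 + frob (frob b) *: f2)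
      = p *: e0 + (q *: f1 + q' *: f2) -> [/\ r = 0, s = 0 & t = 0].
  move=> e; have [|[_ /eqP + /eqP +] [/eqP + _ _]] := ef_indep (r0 := r * a - p)
    (r1 := s * frob a) (r2 := t * frob (frob a))
    (s0 := r * b) (s1 := s * frob b - q) (s2 := t * frob (frob b) - q').
    move/eqP: e; rewrite -subr_eq0 => /eqP e.
    by rewrite -[RHS]e; apply/rowP => j; rewrite !mxE; ring.
  rewrite !mulf_eq0 !fmorph_eq0 (negPf an0) (negPf bn0) !orbF.
  by move=> /eqP -> /eqP -> /eqP ->.
split=> /intersectsP[v [vn0 /extU/span3P[r [s [t vE]]] /span2P[p [q vE']]]].
  case/eqP: vn0; have [|r0 s0 t0] := only0 r s t p q 0.
    by rewrite -vE vE' scale0r addr0.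
  by rewrite vE r0 s0 t0 !scale0r !addr0.
case/eqP: vn0; have [|r0 s0 t0] := only0 r s t p 0 q.
  by rewrite -vE vE' scale0r add0r.
by rewrite vE r0 s0 t0 !scale0r !addr0.
Qed.

Lemma axes_meet E1 E2 : param E1 A -> param E2 B ->
  forall d f, d \in [:: e0; e1; e2] -> f \in [:: f0; f1; f2] ->
  intersects (extension L E1) <<[:: d; f]>>%VS /\
  intersects (extension L E2) <<[:: d; f]>>%VS.
Proof.
move=> E1P E2P d f de ff.
have [[h0 h1 h2] _] := extension_param E1P eE.
have [[k0 k1 k2] _] := extension_param E2P fE.
have [nz_e nz_f] := indep6_neq0 ef_indep.
have dn0 : d != 0 := allP nz_e d de; have fn0 : f != 0 := allP nz_f f ff.
split; apply/intersectsP; [exists d|exists f]; split=> //.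
- by move: de; rewrite !inE => /or3P[] /eqP ->.
- by apply: memv_span; rewrite !inE eqxx.
- by move: ff; rewrite !inE => /or3P[] /eqP ->.
- by apply: memv_span; rewrite !inE eqxx orbT.
Qed.

End Lines.

(** The theorem in the coordinates L + L.  The second cover only serves to
    check that the two axes meet its transversals; every other plane is excluded
    by a transversal of the first. *)
Lemma carriers_unique (S SS C T : set {vspace 'rV[F]_6})
    (E1 E2 : {vspace 'rV[F]_6})
    (gS gC gT : {vspace 'rV[L]_6}) :
  (forall U, S U <-> exists a b : L, (a != 0) || (b != 0) /\
     param U (fun x => A (a * x) + B (b * x))) ->
  (forall U, SS U <->
     exists2 b, norm3 b = 1 & param U (fun x => A x + B (b * x))) ->
  param E1 A -> param E2 B -> covers SS C T ->
  transversal_triple SS gS -> transversal_triple C gC ->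
  transversal_triple T gT ->
  [set U | S U /\
     forall g, (conjugate_triple gS `|` conjugate_triple gC
                `|` conjugate_triple gT) g ->
       intersects (extension L U) g] = [set E1; E2].
Proof.
move=> SP SSP E1P E2P [cC cT sC sT _] trS trC trT.
have [e0 [e1 [e2 [f0 [f1 [f2 [eE fE i6]]]]]]] := twisted_coordinates.
have SE := splash_transversals eE fE i6 (fun U => proj1 (SSP U)) trS.
have homC := cover_homogeneous AB_inj SSP cC sC.
have CE := cover_transversals eE fE i6 homC trC.
have homT := cover_homogeneous AB_inj SSP cT sT.
have TE := cover_transversals eE fE i6 homT trT.
have ax := axes_meet eE fE i6 E1P E2P.
apply/seteqP; split=> U /=.
  case=> /SP[a [b [ab UP]]] meets.
  have [a0|an0] := eqVneq a 0.
    right; apply: param_inj E2P => u; split=> [/UP[x ->]|[x ->]].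
      by exists (b * x); rewrite a0 mul0r linear0 add0r.
    move: ab; rewrite a0 eqxx => bn0; apply/UP; exists (b^-1 * x).
    by rewrite a0 mul0r linear0 add0r mulVKf.
  have [b0|bn0] := eqVneq b 0.
    left; apply: param_inj E1P => u; split=> [/UP[x ->]|[x ->]].
      by exists (a * x); rewrite b0 mul0r linear0 addr0.
    apply/UP; exists (a^-1 * x).
    by rewrite b0 mul0r linear0 addr0 mulVKf.
  have [sk1 sk2] := spread_plane_skew eE fE i6 an0 bn0 UP.
  exfalso; case: CE => CE.
    by apply: sk2; apply: meets; left; right; rewrite CE; left; left.
  by apply: sk1; apply: meets; left; right; rewrite CE; left; left.
have meets E : E = E1 \/ E = E2 -> forall g,
    (conjugate_triple gS `|` conjugate_triple gC `|` conjugate_triple gT) g ->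
    intersects (extension L E) g.
  move=> EE g hg.
  pose joins g' d f := [/\ d \in [:: e0; e1; e2], f \in [:: f0; f1; f2]
    & g' = <<[:: d; f]>>%VS].
  have [d [f [de ff ->]]] : exists d f, joins g d f.
    have nine : forall d f d' f' d'' f'',
        all (mem [:: e0; e1; e2]) [:: d; d'; d''] ->
        all (mem [:: f0; f1; f2]) [:: f; f'; f''] ->
        [set <<[:: d; f]>>%VS; <<[:: d'; f']>>%VS; <<[:: d''; f'']>>%VS] g ->
        exists d f, joins g d f.
      move=> d f d' f' d'' f'' /and4P[h1 h2 h3 _] /and4P[k1 k2 k3 _] [[]|] ->;
      by [exists d, f | exists d', f' | exists d'', f''].
    case: hg => [[]|].
    - by rewrite SE; apply: nine; rewrite /= !inE !eqxx ?orbT.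
    - by case: CE => ->; apply: nine; rewrite /= !inE !eqxx ?orbT.
    - by case: TE => ->; apply: nine; rewrite /= !inE !eqxx ?orbT.
  by have [m1 m2] := ax d f de ff; case: EE => ->.
move=> EE; split; last exact: meets.
apply/SP; case: EE => ->.
  exists 1, 0; rewrite oner_eq0; split=> // u; split=> [/E1P[x ->]|[x ->]].
    by exists x; rewrite mul1r mul0r linear0 addr0.
  by apply/E1P; exists x; rewrite mul1r mul0r linear0 addr0.
exists 0, 1; rewrite oner_eq0 orbT; split=> // u; split=> [/E2P[x ->]|[x ->]].
  by exists x; rewrite mul1r mul0r linear0 add0r.
by apply/E2P; exists x; rewrite mul1r mul0r linear0 add0r.
Qed.

End CarriersMeet.

(** * The Bruck-Bose correspondence *)

Section BruckBose.

Lemma coords_linear (a : F) x y :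
  coords tau (a *: x + y) = a *: coords tau x + coords tau y.
Proof. by apply/rowP => j; rewrite !mxE linearP. Qed.

Lemma coords_eq0 x : coords tau x = 0 -> x = 0.
Proof.
move=> cx0; rewrite (coord_basis (tau_basis dimL prim_tau) (memvf x)).
rewrite big1 // => i _.
by have /rowP/(_ i) := cx0; rewrite !mxE => ->; rewrite scale0r.
Qed.

Variable N : 'M[F]_6.
Hypothesis uN : N \in unitmx.

Definition bb_vector (v : 'rV[L]_3) (x : L) : 'rV[F]_6 :=
  row_mx (coords tau (v 0 0 * x)) (coords tau (v 0 1 * x)).

Fact bb_vector_is_linear v : linear (bb_vector v).
Proof.
move=> a x y.
rewrite /bb_vector !mulrDr -!scalerAr !coords_linear.
by rewrite -add_row_mx -scale_row_mx.
Qed.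

HB.instance Definition _ v := GRing.isLinear.Build F L 'rV[F]_6 *:%R
  (bb_vector v) (bb_vector_is_linear v).

Definition bb_row v (x : L) : 'rV[F]_6 := bb_vector v x *m N.

Fact bb_row_is_linear v : linear (bb_row v).
Proof. by move=> a x y; rewrite /bb_row linearP mulmxDl scalemxAl. Qed.

HB.instance Definition _ v := GRing.isLinear.Build F L 'rV[F]_6 *:%R
  (bb_row v) (bb_row_is_linear v).

Lemma bb_rowD v w x : bb_row (v + w) x = bb_row v x + bb_row w x.
Proof.
have coordsD y z : coords tau (y + z) = coords tau y + coords tau z.
  by rewrite -[y]scale1r coords_linear !scale1r.
by rewrite /bb_row /bb_vector !mxE !mulrDl !coordsD -add_row_mx mulmxDl.
Qed.

Lemma bb_rowZ c v x : bb_row (c *: v) x = bb_row v (c * x).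
Proof. by rewrite /bb_row /bb_vector !mxE !mulrA ![c * _]mulrC. Qed.

Lemma bb_row_inj v : v \in line_infty L -> bb_row v 1 = 0 -> v = 0.
Proof.
rewrite line_inftyP => /eqP v2 /(congr1 (fun u => u *m invmx N)).
rewrite /bb_row /bb_vector mulmxK // mul0mx !mulr1 => e.
have /eq_row_mx[/coords_eq0 v0 /coords_eq0 v1] :
    row_mx (coords tau (v 0 0)) (coords tau (v 0 1)) = row_mx 0 0.
  by rewrite row_mx0; exact: e.
apply/rowP => j; rewrite mxE; case: (unliftP 0 j) => [i ->|-> //].
case: (unliftP 0 i) => [h ->|->].
  by rewrite ord1 -[RHS]v2; congr (v _ _); apply: val_inj.
by rewrite -[RHS]v1; congr (v _ _); apply: val_inj.
Qed.

(** The vector picked on the point [<v>] may be another multiple of [v], which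
    only changes the parametrisation of the plane. *)
Lemma bb_plane_param v : v != 0 ->
  param (mximg N (bb_plane tau <[v]>)) (bb_row v).
Proof.
move=> vn0 u.
have [c cn0 vE] : exists2 c, c != 0 & vpick <[v]> = c *: v.
  have /vlineP[c vE] := memv_pick <[v]>; exists c => //.
  have : vpick <[v]> != 0 by rewrite vpick0 -dimv_eq0 dim_vline vn0.
  by apply: contra_neq => c0; rewrite vE c0 scale0r.
rewrite /bb_plane vE -/(bb_vector (c *: v)); split.
  case/mximgP => _ /memv_imgP[x _ ->] ->; exists (c * x).
  by rewrite -bb_rowZ lfunE.
case=> x ->; apply/mximgP; exists (linfun (bb_vector (c *: v)) (c^-1 * x)).
  by apply/memv_imgP; exists (c^-1 * x); rewrite ?memvf.
by rewrite (lfunE (bb_vector (c *: v))) -[x in LHS](mulVKf cn0) -bb_rowZ.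
Qed.

End BruckBose.

End Core.

Theorem theorem6p5 (F : finFieldType) (L : fieldExtType F)
    (dimL : \dim {:L} = 3%N) (tau : L) (prim_tau : primitive_element tau)
    (S : set {vspace 'rV[F]_6}) (regS : regular_two_spread S)
    (SS : set {vspace 'rV[F]_6}) (E1 E2 : {vspace 'rV[F]_6})
    (splashSS : exterior_splash tau S SS E1 E2)
    (C T : set {vspace 'rV[F]_6}) (coversCT : covers SS C T)
    (gS gC gT : {vspace 'rV[L]_6})
    (trS : transversal_triple SS gS)
    (trC : transversal_triple C gC)
    (trT : transversal_triple T gT) :
  E1 <> E2 /\
  [set U | S U /\
     forall g, (conjugate_triple gS `|` conjugate_triple gC
                `|` conjugate_triple gT) g ->
       intersects (extension L U) g] = [set E1; E2].
Proof.
case: splashSS => N [pi [P1 [P2 [[uN SE] [subpi extpi] SSE carr [-> ->]]]]].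
have [w0 [w1 [w2 fr]]] := exterior_frame dimL prim_tau subpi extpi.
have linf a b : a *: w1 + b *: w2 \in line_infty L.
  by rewrite (line_infty_frame fr); apply/span2P; exists a, b.
(* With - w2 instead of w2 the splash is the set of the <w1 + b (- w2)> with b
   of norm one, and its planes are the graphs of the multiplications by b. *)
pose A := linfun (bb_row tau N w1).
pose B := linfun (bb_row tau N (- w2)).
have AE : A =1 bb_row tau N w1 by move=> x; rewrite lfunE.
have BE : B =1 bb_row tau N (- w2) by move=> x; rewrite lfunE.
have bbE a b x : bb_row tau N (a *: w1 - b *: w2) x = A (a * x) + B (b * x).
  by rewrite AE BE -!bb_rowZ -bb_rowD scalerN.
have w12_eq0 a b : a *: w1 - b *: w2 = 0 -> a = 0 /\ b = 0.
  move=> e; have [|_ -> /eqP] := frame_indep fr (a := 0) (b := a) (c := - b).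
    by rewrite scale0r add0r scaleNr.
  by rewrite oppr_eq0 => /eqP.
have AB_inj x y : A x + B y = 0 -> x = 0 /\ y = 0.
  rewrite -[x]mulr1 -[y]mulr1 -bbE !mulr1 => /(bb_row_inj dimL prim_tau uN).
  by move/(_ _)/w12_eq0; apply; rewrite -scaleNr linf.
have w1n0 : w1 != 0.
  apply/eqP => e; have [|/eqP] := w12_eq0 1 0; last by rewrite oner_eq0.
  by rewrite e scaler0 scale0r subrr.
have w2n0 : w2 != 0.
  apply/eqP => e; have [|_ /eqP] := w12_eq0 0 1; last by rewrite oner_eq0.
  by rewrite e scaler0 scale0r subrr.
have bb1 : param (mximg N (bb_plane tau <[w1]>)) A.
  move=> u; rewrite (bb_plane_param tau N w1n0 u).
  by split=> -[x ->]; exists x; rewrite AE.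
have bb2 : param (mximg N (bb_plane tau <[w2]>)) B.
  move=> u; rewrite (bb_plane_param tau N w2n0 u).
  split=> -[x ->]; exists (- x); rewrite BE.
    by rewrite -[- w2]scaleN1r bb_rowZ mulN1r opprK.
  by rewrite -[- w2]scaleN1r bb_rowZ mulN1r.
have SP U : S U <-> exists a b : L, (a != 0) || (b != 0) /\
     param U (fun x => A (a * x) + B (b * x)).
  have bbP a b : (a != 0) || (b != 0) ->
      param (mximg N (bb_plane tau <[a *: w1 - b *: w2]>))
        (fun x => A (a * x) + B (b * x)).
    move=> ab u; rewrite bb_plane_param.
      by split=> -[x ->]; exists x; rewrite bbE.
    by apply: contraTneq ab => /w12_eq0[-> ->]; rewrite eqxx.
  rewrite SE; split=> [[_ [P [/dim1P[v vn0 ->] vl] <-] <-]|[a [b [ab UP]]]].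
    move: vl; rewrite -memvE (line_infty_frame fr) => /span2P[a [b vE]].
    have ab : (a != 0) || (- b != 0).
      apply: contraNT vn0; rewrite negb_or oppr_eq0 !negbK.
      by case/andP=> /eqP a0 /eqP b0; rewrite vE a0 b0 !scale0r addr0.
    exists a, (- b); split=> //; have := bbP _ _ ab.
    by rewrite scaleNr opprK -vE.
  exists (bb_plane tau <[a *: w1 - b *: w2]>).
  2: exact: param_inj (bbP _ _ ab) UP.
  exists <[a *: w1 - b *: w2]>%VS => //; split.
  2: by rewrite -memvE -scaleNr linf.
  rewrite dim_vline; case: eqP => // /w12_eq0[a0 b0].
  by move: ab; rewrite a0 b0 eqxx.
have SSP U : SS U <->
    exists2 b, norm3 b = 1 & param U (fun x => A x + B (b * x)).
  have bbP b : param (mximg N (bb_plane tau <[w1 - b *: w2]>))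
      (fun x => A x + B (b * x)).
    move=> u; rewrite -[w1]scale1r bb_plane_param.
      by split=> -[x ->]; exists x; rewrite bbE mul1r.
    by apply/eqP => /w12_eq0[/eqP]; rewrite oner_eq0.
  rewrite SSE; split=> [[P]|[b Nb UP]].
    by case/(splash_frame dimL prim_tau fr) => b Nb -> <-; exists b.
  exists <[w1 - b *: w2]>%VS; last exact: param_inj (bbP b) UP.
  by apply/(splash_frame dimL prim_tau fr); exists b.
have neq : mximg N (bb_plane tau <[w1]>) <> mximg N (bb_plane tau <[w2]>).
  move=> e; have /bb1 : exists x, A 1 = A x by exists 1.
  rewrite e => /bb2[y e1].
  have [|/eqP] := AB_inj 1 (- y); last by rewrite oner_eq0.
  by rewrite e1 linearN subrr.
have main :=
  carriers_unique dimL prim_tau AB_inj SP SSP bb1 bb2 coversCT trS trC trT.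
case: (carriers_frame dimL prim_tau fr carr) => -[-> ->].
  by split.
by split; [apply: nesym | rewrite main setUC].
Qed.
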